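(* Let $n\geqslant4$, let $(\overline M,\bar g)$ be a $1$-dimensional manifold with $\bar g_{11}=\varepsilon=\pm1$ and coordinate $x^1$, let $a,b\in\mathbb{R}$, and let $(\widetilde N,\tilde g)$ be an $(n-1)$-dimensional semi-Riemannian manifold which is not an Einstein manifold and satisfies $$\widetilde S_{\mu}{}^{\epsilon}\widetilde R_{\epsilon\beta\gamma\delta}=\frac{\tilde\kappa}{n-1}\,\widetilde R_{\mu\beta\gamma\delta}+\varepsilon a^2\bigl(\tilde g_{\beta\gamma}\widetilde S_{\mu\delta}-\tilde g_{\beta\delta}\widetilde S_{\mu\gamma}\bigr)-\frac{\varepsilon\tilde\kappa a^2}{n-1}\,\widetilde G_{\mu\beta\gamma\delta}.$$ If $F:\overline M\to\mathbb{R}^+$ is $F(x^1)=(ax^1+b)^2$, then the warped product $\overline M\times_F\widetilde N$ satisfies $$R\cdot C-C\cdot R=\frac{1}{n-2}\,Q(S,R).$$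
   Context: All manifolds are connected, paracompact and $C^\infty$. For a semi-Riemannian manifold $(M,g)$ of dimension $n$ with Levi-Civita connection $\nabla$ and a symmetric $(0,2)$-tensor $A$: $(X\wedge_AY)Z=A(Y,Z)X-A(X,Z)Y$; $\mathcal R(X,Y)Z=\nabla_X\nabla_YZ-\nabla_Y\nabla_XZ-\nabla_{[X,Y]}Z$; $S(X,Y)=\mathrm{tr}\{Z\mapsto\mathcal R(Z,X)Y\}$ is the Ricci tensor; the Ricci operator $\mathcal S$ is given by $g(\mathcal SX,Y)=S(X,Y)$; $\kappa=\mathrm{tr}\,\mathcal S$; $\mathcal C(X,Y)=\mathcal R(X,Y)-\frac{1}{n-2}\bigl(X\wedge_g\mathcal SY+\mathcal SX\wedge_gY-\frac{\kappa}{n-1}X\wedge_gY\bigr)$. The $(0,4)$-tensors are $G(X_1,X_2,X_3,X_4)=g((X_1\wedge_gX_2)X_3,X_4)$, $R(X_1,X_2,X_3,X_4)=g(\mathcal R(X_1,X_2)X_3,X_4)$, $C(X_1,X_2,X_3,X_4)=g(\mathcal C(X_1,X_2)X_3,X_4)$ (Weyl tensor). For $\mathcal B\in\{\mathcal R,\mathcal C\}$ with associated $(0,4)$-tensor $B\in\{R,C\}$ and a $(0,k)$-tensor $T$: $(B\cdot T)(X_1,\dots,X_k;X,Y)=-\sum_{i=1}^kT(X_1,\dots,\mathcal B(X,Y)X_i,\dots,X_k)$, and $Q(A,T)(X_1,\dots,X_k;X,Y)=-\sum_{i=1}^kT(X_1,\dots,(X\wedge_AY)X_i,\dots,X_k)$.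 $(M,g)$ is Einstein if $S=\frac{\kappa}{n}g$ at every point ($n=\dim M$). The warped product $\overline M\times_F\widetilde N$ is $\overline M\times\widetilde N$ with metric $g=\pi_1^*\bar g+(F\circ\pi_1)\pi_2^*\tilde g$, $\pi_1,\pi_2$ being the projections. $R,S,C$ refer to $g$; tensors with a tilde ($\widetilde R,\widetilde S,\widetilde G,\tilde\kappa$) are those of $(\widetilde N,\tilde g)$. Greek indices refer to the fiber, $\widetilde R_{\mu\beta\gamma\delta}=\widetilde R(\partial_\mu,\partial_\beta,\partial_\gamma,\partial_\delta)$, and $\widetilde S_\mu{}^\epsilon=\tilde g^{\epsilon\nu}\widetilde S_{\mu\nu}$. Positivity of $F$ means $ax^1+b\neq0$ on $\overline M$. *)

(* Defs.v *)
From HB Require Import structures.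
From mathcomp Require Import all_boot all_order all_algebra.
From mathcomp Require Import all_classical all_reals all_analysis.
From mathcomp Require Import ring.
Import Order.TTheory GRing.Theory Num.Theory.
Import numFieldNormedType.Exports.

Set Implicit Arguments.
Unset Strict Implicit.
Unset Printing Implicit Defensive.

Local Open Scope classical_set_scope.
Local Open Scope ring_scope.

(* Tensors at a point are written in the coordinates of a chart: tangent
   vectors are rows in 'rV[R]_n, and the i-th coordinate vector is
   [coordv i]. Vector fields on a chart are functions 'rV[R]_n -> 'rV[R]_n. *)

Section Calculus.
Context {R : realType}.

Definition coordv n (i : 'I_n) : 'rV[R]_n := delta_mx 0 i.

Definition partial n (i : 'I_n) (f : 'rV[R]_n -> R) (x : 'rV[R]_n) : R :=
  'D_(coordv i) f x.

(* Intended for U open. *)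
Fixpoint Ck n (U : set 'rV[R]_n) (k : nat) (f : 'rV[R]_n -> R) : Prop :=
  match k with
  | 0 => forall x, U x -> {for x, continuous f}
  | k'.+1 => (forall x, U x -> differentiable f x) /\
             (forall i, Ck U k' (partial i f))
  end.

Definition smooth n (U : set 'rV[R]_n) (f : 'rV[R]_n -> R) : Prop :=
  forall k, Ck U k f.

End Calculus.

Section PointwiseTensors.
Context {R : realType} {n : nat}.
Local Notation V := 'rV[R]_n.

Definition tensor k := ('I_k -> V) -> R.

Definition inner (A : 'M[R]_n) (X Y : V) : R := (X *m A *m Y^T) 0 0.

Definition wedge (A : V -> V -> R) (X Y Z : V) : V := A Y Z *: X - A X Z *: Y.

Definition tensor4 (T : V -> V -> V -> V -> R) : tensor 4 :=
  fun v => T (v 0) (v 1) (v 2) (v 3).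

(* (B . T)(v_1,..,v_k; X, Y) *)
Definition dot (B : V -> V -> V -> V) k (T : tensor k)
    (v : 'I_k -> V) (X Y : V) : R :=
  - \sum_(i < k) T [eta v with i |-> B X Y (v i)].

Definition Qtensor (A : V -> V -> R) k (T : tensor k)
    (v : 'I_k -> V) (X Y : V) : R :=
  dot (wedge A) T v X Y.

End PointwiseTensors.

(* g is the matrix of components of a metric in a chart, as a function of the
   coordinates. *)
Section ChartCurvature.
Context {R : realType} {n : nat} (g : 'rV[R]_n -> 'M[R]_n).
Local Notation V := 'rV[R]_n.
Local Notation vfield := (V -> V).

(* Gamma^k_ij *)
Definition christoffel (i j k : 'I_n) (x : V) : R :=
  2^-1 * \sum_l invmx (g x) k l *
    (partial i (fun y => g y j l) x + partial j (fun y => g y i l) x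
     - partial l (fun y => g y i j) x).

Definition nabla (X Y : vfield) : vfield := fun x =>
  \row_k (\sum_i X x 0 i * partial i (fun y => Y y 0 k) x
          + \sum_i \sum_j christoffel i j k x * X x 0 i * Y x 0 j).

Definition lie_bracket (X Y : vfield) : vfield := fun x =>
  \row_k \sum_i (X x 0 i * partial i (fun y => Y y 0 k) x
                 - Y x 0 i * partial i (fun y => X y 0 k) x).

Definition curvature (X Y Z : vfield) : vfield := fun x =>
  nabla X (nabla Y Z) x - nabla Y (nabla X Z) x - nabla (lie_bracket X Y) Z x.

(* Curvature being tensorial, its value on tangent vectors is computed on
   extensions of these to vector fields, here the ones with constant
   components. *)
Definition riem (x : V) (X Y Z : V) : V :=
  curvature (fun=> X) (fun=> Y) (fun=> Z) x.

Definition ricci (x : V) (X Y : V) : R :=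
  \tr (lin1_mx (fun Z => riem x Z X Y)).

Definition ricci_mx (x : V) : 'M[R]_n :=
  \matrix_(i, j) ricci x (coordv i) (coordv j).

(* The entry at (i, j) is S_i^j = g^{jk} S_ik: it is the matrix, acting on rows
   from the right, of the Ricci operator. *)
Definition ricci_op_mx (x : V) : 'M[R]_n := ricci_mx x *m invmx (g x).

Definition ricci_op (x : V) (X : V) : V := X *m ricci_op_mx x.

Definition scalar_curvature (x : V) : R := \tr (ricci_op_mx x).

Definition weyl (x : V) (X Y Z : V) : V :=
  let gx := inner (g x) in
  riem x X Y Z - (n%:R - 2)^-1 *:
    (wedge gx X (ricci_op x Y) Z + wedge gx (ricci_op x X) Y Z
     - (scalar_curvature x / (n%:R - 1)) *: wedge gx X Y Z).

Definition lower (B : V -> V -> V -> V) (x : V) (X1 X2 X3 X4 : V) : R :=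
  inner (g x) (B X1 X2 X3) X4.

Definition G4 (x : V) := lower (wedge (inner (g x))) x.
Definition R4 (x : V) := lower (riem x) x.
Definition C4 (x : V) := lower (weyl x) x.

(* [nabla] is torsion-free and metric, that is, the Levi-Civita connection. *)

Let christoffel_sym (x : V) i j k : (\forall y \near x, (g y)^T = g y) ->
  christoffel i j k x = christoffel j i k x.
Proof.
move=> gsym; rewrite /christoffel; congr (_ * _); apply: eq_bigr => l _.
congr (_ * _); rewrite [partial i _ x + _]addrC; congr (_ + _ - _).
apply: near_eq_derive.
by near=> y; rewrite -[in LHS](near gsym y)// mxE.
Unshelve. all: by end_near.
Qed.

Lemma nabla_torsion_free (X Y : vfield) (x : V) :
    (\forall y \near x, (g y)^T = g y) ->
  nabla X Y x - nabla Y X x = lie_bracket X Y x.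
Proof.
move=> gsym; apply/rowP => k; rewrite !mxE sumrB.
rewrite [X in _ - (_ + X)]exchange_big /=.
rewrite [X in _ - (_ + X)](_ : _ =
  \sum_i \sum_j christoffel i j k x * X x 0 i * Y x 0 j); last first.
  apply: eq_bigr => i _; apply: eq_bigr => j _.
  by rewrite christoffel_sym// mulrAC.
by rewrite opprD addrACA subrr addr0.
Qed.

Lemma christoffel_metric (x : V) (k i j : 'I_n) :
    (\forall y \near x, (g y)^T = g y) -> g x \in unitmx ->
  partial k (fun y => g y i j) x =
    \sum_l christoffel k i l x * g x l j + \sum_l christoffel k j l x * g x i l.
Proof.
move=> gsym gu.
have gS p q : g x p q = g x q p by rewrite -[in LHS](nbhs_singleton gsym) mxE.
have dgS r p q : partial r (fun y => g y p q) x = partial r (fun y => g y q p) x.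
  apply: near_eq_derive.
  by near=> y; rewrite -[in LHS](near gsym y)// mxE.
have low p q r : \sum_l christoffel p q l x * g x l r = 2^-1 *
    (partial p (fun y => g y q r) x + partial q (fun y => g y p r) x
     - partial r (fun y => g y p q) x).
  under eq_bigr do rewrite /christoffel -mulrA mulr_suml.
  rewrite -mulr_sumr exchange_big /=; congr (_ * _).
  rewrite (bigD1 r)//= [X in _ + X]big1 ?addr0 => [|m mr].
    rewrite -[RHS]mul1r; under eq_bigr do rewrite mulrAC.
    rewrite -mulr_suml; congr (_ * _).
    under eq_bigr do rewrite mulrC gS.
    have /matrixP/(_ r r) := mulmxV gu.
    by rewrite !mxE eqxx.
  under eq_bigr do rewrite mulrAC.
  rewrite -mulr_suml; under eq_bigr do rewrite mulrC gS.
  have /matrixP/(_ r m) := mulmxV gu.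
  by rewrite !mxE eq_sym (negbTE mr) => ->; rewrite mul0r.
rewrite low; under [X in _ + X]eq_bigr do rewrite gS.
rewrite low (dgS k j i) (dgS j k i) (dgS i k j).
by field.
Unshelve. all: by end_near.
Qed.

End ChartCurvature.

Definition paracompact (T : topologicalType) : Prop :=
  forall U : set (set T), (forall A, U A -> open A) ->
    \bigcup_(A in U) A = [set: T] ->
  exists W : set (set T),
    [/\ forall A, W A -> open A,
        \bigcup_(A in W) A = [set: T],
        forall A, W A -> exists2 B, U B & A `<=` B &
        forall p : T, exists2 O : set T,
          nbhs p O & finite_set [set A | W A /\ A `&` O !=set0]].

Section Manifolds.
Context {R : realType}.

(* chart_inv is the inverse of chart_map on the image of chart_dom; outside of
   chart_dom, resp. this image, the values of the two functions are junk. *)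
Record chart (T : topologicalType) (n : nat) := Chart {
  chart_dom : set T;
  chart_map : T -> 'rV[R]_n;
  chart_inv : 'rV[R]_n -> T }.

Definition chart_img T n (c : chart T n) : set 'rV[R]_n :=
  chart_map c @` chart_dom c.

Definition is_chart T n (c : chart T n) : Prop :=
  [/\ open (chart_dom c), open (chart_img c),
      forall p, chart_dom c p -> chart_inv c (chart_map c p) = p,
      {within chart_dom c, continuous (chart_map c)} &
      {within chart_img c, continuous (chart_inv c)}].

Definition overlap T n (c d : chart T n) : set 'rV[R]_n :=
  chart_map c @` (chart_dom c `&` chart_dom d).

Definition transition T n (c d : chart T n) : 'rV[R]_n -> 'rV[R]_n :=
  chart_map d \o chart_inv c.

(* The atlas, indexed by chart_index, need not be maximal. *)
Record charted_space (n : nat) := ChartedSpace {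
  carrier :> topologicalType;
  chart_index : Type;
  chart_at : chart_index -> chart carrier n }.

Definition is_manifold n (M : charted_space n) : Prop :=
  [/\ hausdorff_space M, paracompact M, connected [set: M],
      \bigcup_(i in [set: chart_index M]) chart_dom (chart_at i) = [set: M] &
      (forall i : chart_index M, is_chart (chart_at i)) /\
      (forall (i j : chart_index M) (k : 'I_n),
        smooth (overlap (chart_at i) (chart_at j))
          (fun x => transition (chart_at i) (chart_at j) x 0 k))].

(* A (0,2)-tensor field, given by its matrix of components in each chart. *)
Definition tensor_field02 n (M : charted_space n) :=
  chart_index M -> 'rV[R]_n -> 'M[R]_n.

(* On a connected manifold the index of a smooth field of nondegenerate
   symmetric forms is constant, so it need not be required to be. *)
Definition is_metric n (M : charted_space n) (g : tensor_field02 M) : Prop :=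
  [/\ forall i x, chart_img (chart_at i) x -> (g i x)^T = g i x,
      forall i x, chart_img (chart_at i) x -> g i x \in unitmx,
      forall i k l, smooth (chart_img (chart_at i)) (fun x => g i x k l) &
      forall i j x, overlap (chart_at i) (chart_at j) x ->
        let tau := transition (chart_at i) (chart_at j) in
        g i x = 'J tau x *m g j (tau x) *m ('J tau x)^T].

Definition einstein n (M : charted_space n) (g : tensor_field02 M) : Prop :=
  forall i x, chart_img (chart_at i) x ->
    forall X Y, ricci (g i) x X Y =
      scalar_curvature (g i) x / n%:R * inner (g i x) X Y.

(* A smooth injective function whose differential does not vanish. *)
Definition global_coordinate (M : charted_space 1) (x1 : M -> R) : Prop :=
  injective x1 /\
  forall i : chart_index M,
    let f := x1 \o chart_inv (chart_at i) in
    smooth (chart_img (chart_at i)) f /\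
    forall t, chart_img (chart_at i) t -> partial 0 f t != 0.

(* g(d/dx1, d/dx1) = e, where d/dx1 is the vector field v with dx1(v) = 1. *)
Definition coordinate_component (M : charted_space 1) (g : tensor_field02 M)
    (x1 : M -> R) (e : R) : Prop :=
  forall i t, chart_img (chart_at i) t ->
    forall v : 'rV[R]_1, 'D_v (x1 \o chart_inv (chart_at i)) t = 1 ->
      inner (g i t) v v = e.

Section Product.
Context {m n : nat} (M : charted_space m) (N : charted_space n).

Definition prod_chart (c : chart M m) (d : chart N n) :
    chart (M * N)%type (m + n) :=
  {| chart_dom := chart_dom c `*` chart_dom d;
     chart_map := fun p => row_mx (chart_map c p.1) (chart_map d p.2);
     chart_inv := fun z =>
       (chart_inv c (lsubmx z), chart_inv d (rsubmx z)) |}.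

Definition prod_space : charted_space (m + n) :=
  {| carrier := (M * N)%type;
     chart_index := (chart_index M * chart_index N)%type;
     chart_at := fun ij => prod_chart (chart_at ij.1) (chart_at ij.2) |}.

(* In product charts the differentials of the projections are lsubmx and
   rsubmx. *)
Definition warped_metric (gM : tensor_field02 M) (F : M -> R)
    (gN : tensor_field02 N) : tensor_field02 prod_space :=
  fun ij z =>
    block_mx (gM ij.1 (lsubmx z)) 0
             0 (F (chart_inv (chart_at ij.1) (lsubmx z))
                *: gN ij.2 (rsubmx z)).

End Product.
End Manifolds.

(* Main.v *)
(* With h = a x^1 + b the warping function is h^2 and h'' = 0, so the curvature
   of the warped product vanishes as soon as one argument is tangent to the
   base, and on the fiber it is the curvature of the fiber minus
   eps a^2 (X /\ Y).  After subtraction of the eps a^2 terms the condition on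
   the fiber says that the Ricci operator of the warped product acts on the
   first slot of R, hence by the symmetries of R on every slot, as the scalar
   c = kappa / (n - 1).  Writing U(X, Y) = X /\ S Y + S X /\ Y, this gives
   R . U = 0 and U . R = Q(S, R) + c Q(g, R), and the theorem follows by
   expanding C = R - (U - c G) / (n - 2), as R . G = 0. *)

Require Import Defs.
From mathcomp Require Import all_boot all_order all_algebra.
From mathcomp Require Import all_classical all_reals all_analysis.
From mathcomp Require Import ring lra.
Import Order.TTheory GRing.Theory Num.Theory.
Import numFieldNormedType.Exports.

Local Open Scope classical_set_scope.
Local Open Scope ring_scope.

(** * The pointwise identity *)

(** The eigenvalue of the Ricci operator on R equals the coefficient of the scalar term in the Weyl
    tensor; this agreement is what makes all purely metric terms disappear from C . R. R . U = 0
    because R(X, Y) is skew for g and, by the eigenvalue relation, also for S, so it kills every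
    tensor built from g and S.

    The function x^1 lives on the base manifold and need not be the coordinate t of a chart. Writing
    f for x^1 in a chart, the base metric is eps f'^2 dt^2, and f'' enters the Christoffel symbols;
    it drops out of the curvature because h = a f + b has h'' = a f''.

    The curvature of the warped metric is computed from explicit Christoffel symbols in a product
    chart. The symmetries of its (0,4)-tensor in the last pair and between the pairs are inherited
    from the fiber, where they are derived from the metric, down to the symmetry of second partial
    derivatives.

    Two constants share a name: [c] is kappa / (n - 1) in the pointwise lemma and eps a^2 in the
    section on warped products. *)

Section PointwiseAlgebra.
Context {R : realType} {n : nat}.
Local Notation V := 'rV[R]_n.
Implicit Types (X Y Z W : V) (A : 'M[R]_n).

Lemma innerDl A X Y Z : inner A (X + Y) Z = inner A X Z + inner A Y Z.
Proof. by rewrite /inner !mulmxDl mxE. Qed.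

Lemma innerNl A X Z : inner A (- X) Z = - inner A X Z.
Proof. by rewrite /inner !mulNmx mxE. Qed.

Lemma innerZl A k X Z : inner A (k *: X) Z = k * inner A X Z.
Proof. by rewrite /inner -!scalemxAl mxE. Qed.

Lemma innerDr A X Y Z : inner A X (Y + Z) = inner A X Y + inner A X Z.
Proof. by rewrite /inner linearD mulmxDr mxE. Qed.

Lemma innerZr A k X Z : inner A X (k *: Z) = k * inner A X Z.
Proof. by rewrite /inner linearZ -scalemxAr mxE. Qed.

Lemma inner_sym A X Y : A^T = A -> inner A X Y = inner A Y X.
Proof.
move=> sA; rewrite /inner.
have -> : Y *m A *m X^T = (X *m A *m Y^T)^T by rewrite !trmx_mul trmxK sA mulmxA.
by rewrite [RHS]mxE.
Qed.

Lemma dot_tensor4 (B : V -> V -> V -> V) (T : V -> V -> V -> V -> R)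
    (v : 'I_4 -> V) X Y :
  dot B (tensor4 T) v X Y =
  - (T (B X Y (v 0)) (v 1) (v 2) (v 3) + T (v 0) (B X Y (v 1)) (v 2) (v 3)
     + T (v 0) (v 1) (B X Y (v 2)) (v 3) + T (v 0) (v 1) (v 2) (B X Y (v 3))).
Proof.
have e1 : fintype.lift ord0 ord0 = 1 :> 'I_4 by apply: val_inj.
have e2 : fintype.lift ord0 (fintype.lift ord0 ord0) = 2 :> 'I_4 by apply: val_inj.
have e3 : fintype.lift ord0 (fintype.lift ord0 (fintype.lift ord0 ord0)) = 3 :> 'I_4.
  exact: val_inj.
rewrite /dot !big_ord_recl big_ord0 e1 e2 e3 addr0 !addrA.
by rewrite /tensor4 /=.
Qed.

(** [T] does not distinguish [X *m S] from [c *: X], so inserting C(X, Y) in a slot leaves only R(X,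
    Y) and the wedge of [s]: C . R = R . R - L Q(s, R). On the other side R . C = R . R, since C
    differs from R by products of [inner A] and [s], for both of which R(X, Y) is skew. *)
Lemma semisymmetry_of_eigen (A S : 'M[R]_n) (Rm : V -> V -> V -> V) (c L : R)
    (T := fun X Y Z W => inner A (Rm X Y Z) W)
    (s := fun X Y => inner A (X *m S) Y)
    (C := fun X Y Z => Rm X Y Z -
       L *: (wedge (inner A) X (Y *m S) Z + wedge (inner A) (X *m S) Y Z
             - c *: wedge (inner A) X Y Z)) :
  A^T = A -> (forall X Y, s X Y = s Y X) ->
  (forall X X' Y Z W, T (X + X') Y Z W = T X Y Z W + T X' Y Z W) ->
  (forall k X Y Z W, T (k *: X) Y Z W = k * T X Y Z W) ->
  (forall X Y Z W, T X Y Z W = - T Y X Z W) ->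
  (forall X Y Z W, T X Y Z W = - T X Y W Z) ->
  (forall X Y Z W, T X Y Z W = T Z W X Y) ->
  (forall X Y Z W, T (X *m S) Y Z W = c * T X Y Z W) ->
  forall (v : 'I_4 -> V) X Y,
  dot Rm (tensor4 (fun X Y Z W => inner A (C X Y Z) W)) v X Y
    - dot C (tensor4 T) v X Y = L * Qtensor s (tensor4 T) v X Y.
Proof.
move=> sA sS addT scaleT sk12 sk34 pair eig1 v X Y.
have gT X1 X2 X3 X4 : inner A (Rm X1 X2 X3) X4 = T X1 X2 X3 X4 by [].
have sE X1 X2 : inner A (X1 *m S) X2 = s X1 X2 by [].
have CE X1 X2 X3 : C X1 X2 X3 = Rm X1 X2 X3 + (- L * s X2 X3) *: X1
    + (L * inner A X1 X3) *: (X2 *m S) + (- L * inner A X2 X3) *: (X1 *m S)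
    + (L * s X1 X3) *: X2 + (L * c * inner A X2 X3) *: X1
    + (- L * c * inner A X1 X3) *: X2.
  by rewrite /C /wedge !sE; apply/rowP => i; rewrite !mxE; ring.
(* From here on only the expansion [CE] and the symmetries are available, and [ring] treats the
   values of [T] and [s] as atoms. *)
clearbody T s C.
have eig3 X1 X2 X3 X4 : T X1 X2 (X3 *m S) X4 = c * T X1 X2 X3 X4.
  by rewrite pair eig1 -pair.
have eig4 X1 X2 X3 X4 : T X1 X2 X3 (X4 *m S) = c * T X1 X2 X3 X4.
  by rewrite sk34 eig3 (sk34 X1 X2 X3 X4) mulrN.
have gTr X1 X2 X3 X4 : inner A X4 (Rm X1 X2 X3) = T X1 X2 X3 X4.
  by rewrite inner_sym.
(* Self-adjointness of [S] moves it into the fourth slot of [T]. *)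
have sT X1 X2 X3 X4 : s (Rm X1 X2 X3) X4 = c * T X1 X2 X3 X4.
  by rewrite sS -sE inner_sym// gT eig4.
have sTr X1 X2 X3 X4 : s X4 (Rm X1 X2 X3) = c * T X1 X2 X3 X4.
  by rewrite sS sT.
have C4E X1 X2 X3 X4 : inner A (C X1 X2 X3) X4 = T X1 X2 X3 X4 -
    L * (s X2 X3 * inner A X1 X4 - inner A X1 X3 * s X2 X4
      + inner A X2 X3 * s X1 X4 - s X1 X3 * inner A X2 X4
      - c * (inner A X2 X3 * inner A X1 X4 - inner A X1 X3 * inner A X2 X4)).
  by rewrite CE !(innerDl, innerZl, gT, sE); ring.
(* The vectors [X *m S] and [Y *m S] contribute [c] times the metric wedge, which the scalar term of
   [C] cancels. *)
have C1 Z X2 X3 X4 : T (C X Y Z) X2 X3 X4 = T (Rm X Y Z) X2 X3 X4 -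
    L * (s Y Z * T X X2 X3 X4 - s X Z * T Y X2 X3 X4).
  by rewrite CE !(addT, scaleT, eig1); ring.
have C2 X1 Z X3 X4 : T X1 (C X Y Z) X3 X4 = T X1 (Rm X Y Z) X3 X4 -
    L * (s Y Z * T X1 X X3 X4 - s X Z * T X1 Y X3 X4).
  by rewrite sk12 C1 !(sk12 X1); ring.
have C3 X1 X2 Z X4 : T X1 X2 (C X Y Z) X4 = T X1 X2 (Rm X Y Z) X4 -
    L * (s Y Z * T X1 X2 X X4 - s X Z * T X1 X2 Y X4).
  by rewrite pair C1 !(pair X1).
have C4 X1 X2 X3 Z : T X1 X2 X3 (C X Y Z) = T X1 X2 X3 (Rm X Y Z) -
    L * (s Y Z * T X1 X2 X3 X - s X Z * T X1 X2 X3 Y).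
  by rewrite sk34 C3 !(sk34 X1 X2 X3); ring.
have W1 Z X2 X3 X4 : T (wedge s X Y Z) X2 X3 X4 =
    s Y Z * T X X2 X3 X4 - s X Z * T Y X2 X3 X4.
  by rewrite /wedge -scaleNr addT !scaleT mulNr.
have W2 X1 Z X3 X4 : T X1 (wedge s X Y Z) X3 X4 =
    s Y Z * T X1 X X3 X4 - s X Z * T X1 Y X3 X4.
  by rewrite sk12 W1 !(sk12 X1); ring.
have W3 X1 X2 Z X4 : T X1 X2 (wedge s X Y Z) X4 =
    s Y Z * T X1 X2 X X4 - s X Z * T X1 X2 Y X4.
  by rewrite pair W1 !(pair X1).
have W4 X1 X2 X3 Z : T X1 X2 X3 (wedge s X Y Z) =
    s Y Z * T X1 X2 X3 X - s X Z * T X1 X2 X3 Y.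
  by rewrite sk34 W3 !(sk34 X1 X2 X3); ring.
rewrite /Qtensor !dot_tensor4 C1 C2 C3 C4 W1 W2 W3 W4 !C4E !(gT, gTr, sT, sTr).
(* The products left over from R . C cancel in pairs once [T X Y] is read with its last two
   arguments in a fixed order. *)
rewrite !(sk34 X Y (v 2) (v 0)) !(sk34 X Y (v 3) (v 0)).
rewrite !(sk34 X Y (v 2) (v 1)) !(sk34 X Y (v 3) (v 1)).
ring.
Qed.

End PointwiseAlgebra.

(** * Calculus in coordinates *)

Section SecondPartials.
Context {R : realType}.

(** The two difference quotients are the same function of the increment. *)
Lemma derivable_line n (f : 'rV[R]_n -> R) p v (t : R) :
  derivable f (p + t *: v) v -> derivable (fun s : R => f (p + s *: v)) t 1.
Proof.
rewrite /derivable; set q := (X in cvg (X @ _)) => cq.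
rewrite (_ : (fun h => _) = q)//; apply/funext => h.
by rewrite /q /shift/= scaler1 scalerDl addrCA.
Qed.

Lemma derive_line n (f : 'rV[R]_n -> R) p v (t : R) :
  'D_1 (fun s : R => f (p + s *: v)) t = 'D_v f (p + t *: v).
Proof.
rewrite /derive; set q := (X in _ = lim (X @ _)).
rewrite (_ : (fun h => _) = q)//; apply/funext => h.
by rewrite /q /shift/= scaler1 scalerDl addrCA.
Qed.

(** The mean value theorem is used twice: along [u] on the difference of two parallel edges, then
    along [v] on the resulting difference of ['D_u f]. The second difference is symmetric in [u] and
    [v], while the right-hand side is not. *)
Lemma second_difference n (f : 'rV[R]_n -> R) p u v (t : R) : 0 < t ->
  (forall s r, 0 <= s <= t -> 0 <= r <= t ->
    derivable f (p + r *: v + s *: u) u /\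
    derivable ('D_u f) (p + s *: u + r *: v) v) ->
  exists s r, [/\ 0 <= s <= t, 0 <= r <= t &
    f (p + t *: v + t *: u) - f (p + t *: u) - f (p + t *: v) + f p
    = 'D_v ('D_u f) (p + s *: u + r *: v) * t * t].
Proof.
move=> t0 df.
have tt : 0 <= t <= t by rewrite lexx ltW.
have t00 : (0 : R) <= 0 <= t by rewrite lexx ltW.
pose phi := (fun s : R => f (p + t *: v + s *: u)) - (fun s : R => f (p + s *: u)).
have dphi s : 0 <= s <= t -> is_derive s 1 phi
    ('D_u f (p + s *: u + t *: v) - 'D_u f (p + s *: u)).
  move=> sI; rewrite addrAC -2!derive_line.
  apply: is_deriveB; apply/derivableP; apply: derivable_line.
    exact: (df s t sI tt).1.
  by have := (df s 0 sI t00).1; rewrite scale0r addr0.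
have [||s] := @MVT _ phi
    (fun s => 'D_u f (p + s *: u + t *: v) - 'D_u f (p + s *: u)) 0 t t0.
  by move=> s; rewrite in_itv/= => /andP[s0 st]; apply: dphi; rewrite !ltW.
  apply: derivable_within_continuous => s; rewrite in_itv/= => sI.
  by have [] := dphi s sI.
rewrite in_itv/= subr0 => /andP[s0 st].
have sI : 0 <= s <= t by rewrite !ltW.
have [||r] := @MVT _ (fun r : R => 'D_u f (p + s *: u + r *: v))
    (fun r => 'D_v ('D_u f) (p + s *: u + r *: v)) 0 t t0.
  move=> r; rewrite in_itv/= => /andP[r0 rt]; rewrite -derive_line.
  apply/derivableP; apply: (@derivable_line _ ('D_u f)).
  by have [] := df s r sI; rewrite ?ltW.
  apply: derivable_within_continuous => r; rewrite in_itv/= => rI.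
  by apply: (@derivable_line _ ('D_u f)); have [] := df s r sI rI.
rewrite in_itv/= subr0 scale0r addr0 => /andP[r0 rt] -> phit.
exists s, r; rewrite !ltW//; split=> //.
by rewrite -phit /phi !fctE/= !scale0r !addr0; ring.
Qed.

(** Schwarz's theorem. One second difference equals both mixed derivatives, each at its own
    intermediate point and times [t * t]; continuity at [x] makes each of them [e / 2]-close to its
    value there. *)
Lemma partialC n (U : set 'rV[R]_n) (f : 'rV[R]_n -> R) x i j :
  open U -> Ck U 2 f -> U x ->
  partial i (partial j f) x = partial j (partial i f) x.
Proof.
move=> oU [df Cf] Ux.
pose u : 'rV[R]_n := coordv i; pose v : 'rV[R]_n := coordv j.
have [_ /(_ j) cji] := Cf i; have [_ /(_ i) cij] := Cf j.
have nU : nbhs x U by exact: open_nbhs_nbhs.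
suff close (e : R) : 0 < e -> `|partial i (partial j f) x - partial j (partial i f) x| < e.
  apply/eqP; rewrite -subr_eq0; apply/negPn/negP => ne.
  by have := close `|partial i (partial j f) x - partial j (partial i f) x|;
    rewrite normr_gt0 ltxx => /(_ ne).
move=> e0; have e20 : 0 < e / 2 by rewrite divr_gt0.
have := cij x Ux; move=> /cvgrPdist_lt/(_ _ e20) nij.
have := cji x Ux; move=> /cvgrPdist_lt/(_ _ e20) nji.
have [d /= d0 H] := (nbhs_ballP x _).1 (filterI nU (filterI nij nji)).
(* The summand 1 makes [M] positive at once. With [t = d / (2 * M)] every point of the parallelogram
   is within [t * M = d / 2] of [x]. *)
pose M := `|u| + `|v| + 1.
have M0 : 0 < M by rewrite ltr_wpDl.
pose t := d / (2 * M).
have t0 : 0 < t by rewrite divr_gt0// mulr_gt0.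
have near_x s r : 0 <= s <= t -> 0 <= r <= t -> ball x d (x + s *: u + r *: v).
  move=> /andP[s0 st] /andP[r0 rt].
  rewrite -ball_normE /ball_/= -addrA opprD addrA subrr add0r normrN.
  have : `|s *: u + r *: v| <= t * M.
    rewrite (le_trans (ler_normD _ _))// !normrZ !ger0_norm// /M !mulrDr mulr1.
    by rewrite -[leLHS]addr0 lerD ?(ltW t0)// lerD// ler_wpM2r.
  move=> /le_lt_trans; apply.
  rewrite /t invfM mulrA mulfVK ?gt_eqF// ltr_pdivrMr//.
  by rewrite mulr_natr mulr2n ltrDr.
have near_x' s r : 0 <= s <= t -> 0 <= r <= t -> ball x d (x + r *: v + s *: u).
  by move=> sI rI; rewrite addrAC; apply: near_x.
have [|s [r [sI rI E]]] := @second_difference n f x u v t t0.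
  move=> s r sI rI; split; apply: diff_derivable.
    by apply: df; apply: (H _ (near_x' _ _ sI rI)).1.
  by have [dfi _] := Cf i; apply: dfi; apply: (H _ (near_x _ _ sI rI)).1.
have [|s' [r' [sI' rI' E']]] := @second_difference n f x v u t t0.
  move=> s' r' sI' rI'; split; apply: diff_derivable.
    by apply: df; apply: (H _ (near_x _ _ rI' sI')).1.
  by have [dfi _] := Cf j; apply: dfi; apply: (H _ (near_x' _ _ rI' sI')).1.
have [_ [_ h1]] := H _ (near_x _ _ sI rI).
have [_ [h2 _]] := H _ (near_x' _ _ rI' sI').
have E2 : 'D_v ('D_u f) (x + s *: u + r *: v) =
          'D_u ('D_v f) (x + s' *: v + r' *: u).
  apply: (mulIf (lt0r_neq0 t0)); apply: (mulIf (lt0r_neq0 t0)).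
  have xuv : x + t *: u + t *: v = x + t *: v + t *: u by rewrite addrAC.
  rewrite -[LHS]E -[RHS]E' xuv; congr (_ + _).
  by move: (f (x + _ + _)) (f (x + t *: u)) (f (x + t *: v)) => *; rewrite addrAC.
have -> : partial i (partial j f) x - partial j (partial i f) x =
    (partial i (partial j f) x - 'D_u ('D_v f) (x + s' *: v + r' *: u))
    - (partial j (partial i f) x - 'D_v ('D_u f) (x + s *: u + r *: v)).
  by rewrite E2 opprB addrA addrNK.
apply: (le_lt_trans (ler_normB _ _)); rewrite [ltRHS]splitr.
by apply: ltrD; [exact: h2|exact: h1].
Qed.

End SecondPartials.

(** * Derivatives of sums, products, determinants and inverse matrices *)

Section PartialDerivatives.
Context {R : realType} {V : normedModType R}.
Implicit Types (f g : V -> R) (x v : V).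

Lemma derivable_bigsum (I : Type) (r : seq I) (P : pred I) (F : I -> V -> R) x v :
  (forall i, derivable (F i) x v) ->
  derivable (fun y => \sum_(i <- r | P i) F i y) x v.
Proof.
move=> dF; elim: r => [|i r IH].
  by under eq_fun do rewrite big_nil; exact: derivable_cst.
under eq_fun do rewrite big_cons; case: (P i); last exact: IH.
exact: derivableD (dF i) IH.
Qed.

Lemma derive_bigsum (I : Type) (r : seq I) (P : pred I) (F : I -> V -> R) x v :
  (forall i, derivable (F i) x v) ->
  'D_v (fun y => \sum_(i <- r | P i) F i y) x = \sum_(i <- r | P i) 'D_v (F i) x.
Proof.
move=> dF; elim: r => [|i r IH].
  by under eq_fun do rewrite big_nil; rewrite big_nil derive_cst.
under eq_fun do rewrite big_cons; rewrite big_cons; case: (P i) => //.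
by rewrite -IH -deriveD//; exact: derivable_bigsum.
Qed.

Lemma derivable_bigprod (I : Type) (r : seq I) (P : pred I) (F : I -> V -> R) x v :
  (forall i, derivable (F i) x v) ->
  derivable (fun y => \prod_(i <- r | P i) F i y) x v.
Proof.
move=> dF; elim: r => [|i r IH].
  by under eq_fun do rewrite big_nil; exact: derivable_cst.
under eq_fun do rewrite big_cons; case: (P i); last exact: IH.
exact: derivableM (dF i) IH.
Qed.

Lemma derive_mul f g x v : derivable f x v -> derivable g x v ->
  'D_v (fun y => f y * g y) x = f x * 'D_v g x + g x * 'D_v f x.
Proof. exact: deriveM. Qed.

Lemma derive_mulC f c x v : derivable f x v ->
  'D_v (fun y => f y * c) x = 'D_v f x * c.
Proof. by rewrite mulrC; exact: deriveMr. Qed.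

Lemma derivable_mulC f c x v : derivable f x v -> derivable (fun y => f y * c) x v.
Proof. by move=> df; apply: (derivableM df); exact: derivable_cst. Qed.

Lemma derivable_det n (M : V -> 'M[R]_n) x v :
  (forall i j, derivable (fun y => M y i j) x v) ->
  derivable (fun y => \det (M y)) x v.
Proof.
move=> dM; rewrite /determinant; apply: derivable_bigsum => s.
by apply: derivableM; [exact: derivable_cst|exact: derivable_bigprod].
Qed.

(** Cramer's rule: each entry is a cofactor over the determinant. Invertibility is asked near [x]
    because [invmx] returns its argument on singular matrices. *)
Lemma derivable_invmx n (M : V -> 'M[R]_n) x v i j :
  (\forall y \near x, M y \in unitmx) ->
  (forall i j, derivable (fun y => M y i j) x v) ->
  derivable (fun y => invmx (M y) i j) x v.
Proof.
move=> uM dM.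
apply: (@near_eq_derivable _ _ _
  (fun y => (\det (M y))^-1 * ((-1) ^+ (j + i) * \det (row' j (col' i (M y)))))).
  by near=> y; rewrite /invmx (near uM y)// !mxE.
apply: derivableM.
  apply: derivableV; last exact: derivable_det.
  by rewrite -unitfE -unitmxE; exact: nbhs_singleton uM.
apply: derivableM; first exact: derivable_cst.
by apply: derivable_det => k l; under eq_fun do rewrite !mxE; exact: dM.
Unshelve. all: by end_near.
Qed.

End PartialDerivatives.

(** * Symmetries of the curvature tensor *)

Section CurvatureComponents.
Context {R : realType} {n : nat}.
Local Notation V := 'rV[R]_n.

Lemma coordvE (i j : 'I_n) : (coordv i : V) 0 j = (j == i)%:R.
Proof. by rewrite mxE eqxx. Qed.

(** Multilinear identities are reduced to components by applying this to the difference of the two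
    sides, one slot after another. *)
Lemma linear_ext (f : V -> R) :
  (forall k X Y, f (k *: X + Y) = k * f X + f Y) ->
  (forall i, f (coordv i) = 0) -> forall X, f X = 0.
Proof.
move=> lf f0 X.
have fz : f 0 = 0.
  have := lf (-1) 0 0; rewrite scaler0 addr0 mulN1r addNr => ->//.
have fsum (r : seq 'I_n) : f (\sum_(i <- r) X 0 i *: coordv i) = 0.
  elim: r => [|i r IH]; first by rewrite big_nil.
  by rewrite big_cons lf f0 IH mulr0 addr0.
by rewrite [X]row_sum_delta fsum.
Qed.

Variable g : V -> 'M[R]_n.

Lemma christoffel_symmetric (x : V) i j k : (\forall y \near x, (g y)^T = g y) ->
  christoffel g i j k x = christoffel g j i k x.
Proof.
move=> gsym; rewrite /christoffel; congr (_ * _); apply: eq_bigr => l _.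
congr (_ * _); rewrite [partial i _ x + _]addrC; congr (_ + _ - _).
apply: near_eq_derive.
by near=> y; rewrite -[in LHS](near gsym y)// mxE.
Unshelve. all: by end_near.
Qed.

(* The component of [riem (coordv i) (coordv j) (coordv l)] on [coordv k]. *)
Definition riem_component (i j l k : 'I_n) (x : V) : R :=
  partial i (christoffel g j l k) x - partial j (christoffel g i l k) x
  + \sum_m (christoffel g i m k x * christoffel g j l m x
            - christoffel g j m k x * christoffel g i l m x).

Lemma nabla_const (Y Z : V) :
  nabla g (fun=> Y) (fun=> Z) = fun x =>
    \row_k \sum_i \sum_j christoffel g i j k x * Y 0 i * Z 0 j.
Proof.
apply/funext => x; apply/rowP => k; rewrite !mxE.
rewrite big1 ?add0r// => i _.
by rewrite /partial derive_cst mulr0.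
Qed.

(** The regularity under which curvature has its component formula. Kept apart from smoothness of
    the metric, it can also be read off from explicitly known symbols, as is done for the warped
    metric. *)
Definition derivable_christoffel (x : V) :=
  forall i j k v, derivable (christoffel g i j k) x v.

Lemma nabla_nabla_const (X Y Z : V) x k : derivable_christoffel x ->
  nabla g (fun=> X) (nabla g (fun=> Y) (fun=> Z)) x 0 k =
  \sum_i \sum_j \sum_l X 0 i * Y 0 j * Z 0 l *
    (partial i (christoffel g j l k) x
     + \sum_m christoffel g i m k x * christoffel g j l m x).
Proof.
move=> dG.
(* The regroupings are proved on bare reals, so that [ring] never meets the derivatives and sums
   themselves. *)
have auxl (a b c d : R) : a * (d * b * c) = a * b * c * d by ring.
have auxr (a b c d e : R) : d * a * (e * b * c) = a * b * c * (d * e) by ring.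
rewrite nabla_const mxE -big_split; apply: eq_bigr => i _ /=.
have -> : partial i (fun y => (\row_k0 \sum_i0 \sum_j christoffel g i0 j k0 y *
    Y 0 i0 * Z 0 j) 0 k) x =
    \sum_j \sum_l partial i (christoffel g j l k) x * Y 0 j * Z 0 l.
  under [X in partial i X]eq_fun do rewrite mxE.
  have dYZ j l : derivable (fun y => christoffel g j l k y * Y 0 j * Z 0 l) x (coordv i).
    by apply: derivable_mulC; exact: derivable_mulC.
  rewrite /partial derive_bigsum => [|j]; last exact: derivable_bigsum.
  apply: eq_bigr => j _; rewrite derive_bigsum//; apply: eq_bigr => l _.
  by rewrite derive_mulC ?derive_mulC//; exact: derivable_mulC.
under [X in _ + X]eq_bigr => m _.
  rewrite mxE mulr_sumr; under eq_bigr do rewrite mulr_sumr; over.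
rewrite /= [X in _ + X = _]exchange_big mulr_sumr -big_split; apply: eq_bigr => j _ /=.
rewrite [X in _ + X = _]exchange_big mulr_sumr -big_split; apply: eq_bigr => l _ /=.
rewrite mulrDr mulr_sumr; congr (_ + _); first by rewrite auxl.
apply: eq_bigr => m _; by rewrite auxr.
Qed.

Lemma lie_bracket_const (X Y : V) : lie_bracket (fun=> X) (fun=> Y) = fun=> 0.
Proof.
apply/funext => y; apply/rowP => p; rewrite !mxE big1// => i _.
by rewrite /partial !derive_cst !mulr0 subrr.
Qed.

Lemma nabla0 (Z : V -> V) x : nabla g (fun=> 0) Z x = 0.
Proof.
apply/rowP => p; rewrite !mxE big1 ?add0r => [|i _]; last by rewrite mxE mul0r.
by rewrite big1// => i _; rewrite big1// => j _; rewrite mxE mulr0 mul0r.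
Qed.

Lemma riem_const X Y Z x : riem g x X Y Z =
  nabla g (fun=> X) (nabla g (fun=> Y) (fun=> Z)) x -
  nabla g (fun=> Y) (nabla g (fun=> X) (fun=> Z)) x.
Proof. by rewrite /riem /curvature lie_bracket_const nabla0 subr0. Qed.

(** Constant-component fields commute, so only the commutator of the second derivatives contributes.
    This form exhibits [riem] as trilinear in the components. *)
Lemma riemE (X Y Z : V) x k : derivable_christoffel x ->
  riem g x X Y Z 0 k =
  \sum_i \sum_j \sum_l X 0 i * Y 0 j * Z 0 l * riem_component i j l k x.
Proof.
have aux (a b c p q r s : R) : a * b * c * (p + q) - b * a * c * (r + s) =
  a * b * c * (p - r + (q - s)) by ring.
move=> dG; rewrite riem_const mxE [X in _ + X]mxE !nabla_nabla_const//.
rewrite [X in _ + - X]exchange_big /= -sumrB; apply: eq_bigr => i _.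
rewrite -sumrB; apply: eq_bigr => j _; rewrite -sumrB; apply: eq_bigr => l _.
by rewrite /riem_component sumrB aux.
Qed.

Lemma sum3_coordv (F : 'I_n -> 'I_n -> 'I_n -> R) a b c :
  \sum_i \sum_j \sum_l (coordv a : V) 0 i * (coordv b : V) 0 j * (coordv c : V) 0 l * F i j l
  = F a b c.
Proof.
rewrite (bigD1 a)//= (bigD1 b)//= (bigD1 c)//= !coordvE !eqxx !mul1r.
rewrite big1 ?addr0 => [|p pl]; last by rewrite coordvE (negbTE pl) mulr0 mul0r.
rewrite big1 ?addr0 => [|p pl]; last first.
  by rewrite big1// => q _; rewrite coordvE (negbTE pl) mulr0 !mul0r.
rewrite big1 ?addr0// => p pl.
by rewrite big1// => q _; rewrite big1// => r _; rewrite coordvE (negbTE pl) !mul0r.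
Qed.

Lemma riem_coordv i j l k x : derivable_christoffel x ->
  riem g x (coordv i) (coordv j) (coordv l) 0 k = riem_component i j l k x.
Proof.
move=> dG; apply: etrans (riemE _ _ _ _ _ dG) _.
exact: (sum3_coordv (fun i j l => riem_component i j l k x)).
Qed.

Lemma riem_linear1 k X X' Y Z x : derivable_christoffel x ->
  riem g x (k *: X + X') Y Z = k *: riem g x X Y Z + riem g x X' Y Z.
Proof.
have aux (p q r t u : R) : (k * p + q) * r * t * u = k * (p * r * t * u) + q * r * t * u by ring.
move=> dG; apply/rowP => p; rewrite [RHS]mxE [X in _ = X + _]mxE [LHS]riemE//
  [X in _ = _ * X + _]riemE// [X in _ = _ + X]riemE// mulr_sumr -big_split.
apply: eq_bigr => i _; rewrite mulr_sumr -big_split; apply: eq_bigr => j _.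
by rewrite mulr_sumr -big_split; apply: eq_bigr => l _; rewrite !mxE /= aux.
Qed.

Lemma riem_linear2 k X Y Y' Z x : derivable_christoffel x ->
  riem g x X (k *: Y + Y') Z = k *: riem g x X Y Z + riem g x X Y' Z.
Proof.
have aux (p q r t u : R) : r * (k * p + q) * t * u = k * (r * p * t * u) + r * q * t * u by ring.
move=> dG; apply/rowP => p; rewrite [RHS]mxE [X in _ = X + _]mxE [LHS]riemE//
  [X in _ = _ * X + _]riemE// [X in _ = _ + X]riemE// mulr_sumr -big_split.
apply: eq_bigr => i _; rewrite mulr_sumr -big_split; apply: eq_bigr => j _.
by rewrite mulr_sumr -big_split; apply: eq_bigr => l _; rewrite !mxE /= aux.
Qed.

Lemma riem_linear3 k X Y Z Z' x : derivable_christoffel x ->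
  riem g x X Y (k *: Z + Z') = k *: riem g x X Y Z + riem g x X Y Z'.
Proof.
have aux (p q r t u : R) : r * t * (k * p + q) * u = k * (r * t * p * u) + r * t * q * u by ring.
move=> dG; apply/rowP => p; rewrite [RHS]mxE [X in _ = X + _]mxE [LHS]riemE//
  [X in _ = _ * X + _]riemE// [X in _ = _ + X]riemE// mulr_sumr -big_split.
apply: eq_bigr => i _; rewrite mulr_sumr -big_split; apply: eq_bigr => j _.
by rewrite mulr_sumr -big_split; apply: eq_bigr => l _; rewrite !mxE /= aux.
Qed.

Lemma riem_skew X Y Z x : riem g x X Y Z = - riem g x Y X Z.
Proof.
by rewrite !riem_const opprB.
Qed.

End CurvatureComponents.

(** * Skew symmetry, Bianchi identity and pair symmetry for the curvature of a metric *)

Section MetricCurvature.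
Context {R : realType} {n : nat}.
Local Notation V := 'rV[R]_n.

(** Curvature at a point depends only on the metric near it, so the setting is a single chart with
    open image. *)
Definition metric_on (U : set V) (g : V -> 'M[R]_n) : Prop :=
  [/\ open U, forall x, U x -> (g x)^T = g x, forall x, U x -> g x \in unitmx &
      forall k l, smooth U (fun x => g x k l)].

Variables (U : set V) (g : V -> 'M[R]_n).
Hypothesis gU : metric_on U g.

Lemma metric_near_sym x : U x -> \forall y \near x, (g y)^T = g y.
Proof.
case: gU => oU gS _ _ Ux; near=> y; apply: gS; near: y.
exact: open_nbhs_nbhs.
Unshelve. all: by end_near.
Qed.

Lemma metric_near_unit x : U x -> \forall y \near x, g y \in unitmx.
Proof.
case: gU => oU _ gu _ Ux; near=> y; apply: gu; near: y.
exact: open_nbhs_nbhs.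
Unshelve. all: by end_near.
Qed.

Lemma metric_derivable_christoffel x : U x -> derivable_christoffel g x.
Proof.
move=> Ux i j k v; case: gU => oU gS gu gC.
have dg p q : derivable (fun y => g y p q) x v.
  by apply: diff_derivable; case: (gC p q 1) => df _; exact: df.
have ddg r p q : derivable (partial r (fun y => g y p q)) x v.
  by apply: diff_derivable; case: (gC p q 2) => _ /(_ r)[df _]; exact: df.
rewrite /christoffel; apply: derivableM; first exact: derivable_cst.
apply: derivable_bigsum => l; apply: derivableM.
  by apply: derivable_invmx => //; exact: metric_near_unit.
by apply: derivableB => //; exact: derivableD.
Qed.

(** The Christoffel symbols of the first kind. *)
Definition christoffel_lower (i j p : 'I_n) (x : V) : R :=
  \sum_l christoffel g i j l x * g x l p.

Lemma partial_metric x k i j : U x -> partial k (fun y => g y i j) x =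
  christoffel_lower k i j x + christoffel_lower k j i x.
Proof.
move=> Ux; have [_ gS gu _] := gU.
rewrite christoffel_metric; [|exact: metric_near_sym|exact: gu].
congr (_ + _); apply: eq_bigr => l _; congr (_ * _).
by rewrite -[in LHS](gS x Ux) mxE.
Qed.

(** Lowering the index under the derivative costs the derivative of the metric, which splits into
    two symbols of the first kind. One of them cancels the quadratic term of the curvature; the
    other is the sum on the right. *)
Lemma riem_component_lower x i j l p : U x ->
  \sum_k riem_component g i j l k x * g x k p =
  (partial i (christoffel_lower j l p) x
     - \sum_k christoffel g j l k x * christoffel_lower i p k x)
  - (partial j (christoffel_lower i l p) x
     - \sum_k christoffel g i l k x * christoffel_lower j p k x).
Proof.
move=> Ux; have dG := metric_derivable_christoffel _ Ux.
have [_ _ _ gC] := gU.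
have dg p' q v : derivable (fun y => g y p' q) x v.
  by apply: diff_derivable; case: (gC p' q 1) => df _; exact: df.
have key a b : \sum_k (partial a (christoffel g b l k) x * g x k p +
      \sum_m christoffel g a m k x * christoffel g b l m x * g x k p) =
    partial a (christoffel_lower b l p) x
      - \sum_k christoffel g b l k x * christoffel_lower a p k x.
  rewrite big_split [X in _ + X = _]exchange_big -big_split.
  rewrite [in RHS]/partial derive_bigsum => [|k]; last exact: derivableM.
  rewrite -sumrB; apply: eq_bigr => k _ /=.
  have -> : \sum_m christoffel g a k m x * christoffel g b l k x * g x m p =
      christoffel g b l k x * christoffel_lower a k p x.
    by rewrite mulr_sumr; apply: eq_bigr => m _; rewrite mulrAC mulrC.
  rewrite derive_mul// (partial_metric _ _ _ _ Ux : 'D_(coordv a) _ x = _).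
  rewrite mulrDr addrAC addrK addrC; congr (_ + _).
  exact: mulrC.
apply: etrans (congr2 (fun a b => a - b) (key i j) (key j i)).
rewrite -sumrB; apply: eq_bigr => k _.
rewrite /riem_component sumrB -!mulr_suml.
move: (partial i _ _) (partial j _ _) (\sum_m _) (\sum_m _) (g x k p).
by move=> *; ring.
Qed.

(** Symmetrizing in [l] and [p] turns the derivative terms into second derivatives of g_lp, whose
    antisymmetrization in [i] and [j] vanishes by [partialC]. The quadratic terms are metric
    pairings of two Christoffel vectors, symmetric since the metric is, and cancel too. *)
Lemma riem_component_skew34 x i j l p : U x ->
  \sum_k riem_component g i j l k x * g x k p =
  - \sum_k riem_component g i j p k x * g x k l.
Proof.
move=> Ux; have [oU gS gu gC] := gU.
have dlow a b c v : derivable (christoffel_lower a b c) x v.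
  apply: derivable_bigsum => k; apply: derivableM.
    exact: metric_derivable_christoffel.
  by apply: diff_derivable; case: (gC k c 1) => df _; exact: df.
have hess a b : partial a (partial b (fun y => g y l p)) x =
    partial a (christoffel_lower b l p) x + partial a (christoffel_lower b p l) x.
  rewrite /partial -deriveD//; apply: near_eq_derive.
  near=> y; apply: (partial_metric _ b l p).
  by near: y; exact: open_nbhs_nbhs.
pose pr a b c d := \sum_k christoffel g a b k x * christoffel_lower c d k x.
have pairing a b c d : pr a b c d = pr c d a b.
  rewrite /pr /christoffel_lower; under eq_bigr do rewrite mulr_sumr.
  rewrite exchange_big; apply: eq_bigr => k _; rewrite mulr_sumr.
  apply: eq_bigr => m _; rewrite mulrCA; congr (_ * (_ * _)).
  by rewrite -[in LHS](gS x Ux) mxE.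
have lowE c d : \sum_k riem_component g i j c k x * g x k d =
    (partial i (christoffel_lower j c d) x - pr j c i d)
    - (partial j (christoffel_lower i c d) x - pr i c j d).
  exact: riem_component_lower.
clearbody pr; rewrite !lowE (pairing i p j l) (pairing j p i l).
have := @partialC _ _ _ _ x i j oU (gC l p 2) Ux; rewrite !hess.
move: (partial i _ _) (partial i _ _) (partial j _ _) (partial j _ _).
move: (pr _ _ _ _) (pr _ _ _ _) => *; lra.
Unshelve. all: by end_near.
Qed.

(** By torsion-freeness the derivative and quadratic terms are symmetric in their last two lower
    indices, so the cyclic sum cancels in pairs. *)
Lemma riem_component_bianchi x i j l k : U x ->
  riem_component g i j l k x + riem_component g j l i k x
  + riem_component g l i j k x = 0.
Proof.
move=> Ux; have [oU _ _ _] := gU.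
have cS a b c : christoffel g a b c x = christoffel g b a c x.
  by apply: christoffel_symmetric; exact: metric_near_sym.
have dcS d a b c : partial d (christoffel g a b c) x = partial d (christoffel g b a c) x.
  apply: near_eq_derive; near=> y; apply: christoffel_symmetric.
  by apply: metric_near_sym; near: y; exact: open_nbhs_nbhs.
pose S a b c := \sum_m christoffel g a m k x * christoffel g b c m x.
have sw a b c : S a b c = S a c b by apply: eq_bigr => m _; rewrite (cS b c).
pose D d a b := partial d (christoffel g a b k) x.
have swD d a b : D d a b = D d b a by exact: dcS.
have rcE a b c : riem_component g a b c k x = D a b c - D b a c + (S a b c - S b a c).
  by rewrite /riem_component sumrB.
clearbody S D; rewrite !rcE (swD j l) (swD l j) (swD i l) (sw j i) (sw l j) (sw i l).
ring.
Unshelve. all: by end_near.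
Qed.

Lemma R4_linear1 x k X X' Y Z W : U x ->
  R4 g x (k *: X + X') Y Z W = k * R4 g x X Y Z W + R4 g x X' Y Z W.
Proof.
move=> /metric_derivable_christoffel dG.
by rewrite /R4 /lower riem_linear1// innerDl innerZl.
Qed.

Lemma R4_linear2 x k X Y Y' Z W : U x ->
  R4 g x X (k *: Y + Y') Z W = k * R4 g x X Y Z W + R4 g x X Y' Z W.
Proof.
move=> /metric_derivable_christoffel dG.
by rewrite /R4 /lower riem_linear2// innerDl innerZl.
Qed.

Lemma R4_linear3 x k X Y Z Z' W : U x ->
  R4 g x X Y (k *: Z + Z') W = k * R4 g x X Y Z W + R4 g x X Y Z' W.
Proof.
move=> /metric_derivable_christoffel dG.
by rewrite /R4 /lower riem_linear3// innerDl innerZl.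
Qed.

Lemma R4_linear4 x k X Y Z W W' :
  R4 g x X Y Z (k *: W + W') = k * R4 g x X Y Z W + R4 g x X Y Z W'.
Proof. by rewrite /R4 /lower innerDr innerZr. Qed.

Lemma inner_coordvr (A : 'M[R]_n) (X : V) p :
  inner A X (coordv p) = \sum_k X 0 k * A k p.
Proof.
rewrite /inner [LHS]mxE (bigD1 p)//= big1 ?addr0 => [|q qp].
  by rewrite [X in X * _]mxE [X in _ * X]mxE coordvE eqxx mulr1.
by rewrite [X in _ * X]mxE coordvE (negbTE qp) mulr0.
Qed.

Lemma R4_coordv x i j l p : U x ->
  R4 g x (coordv i) (coordv j) (coordv l) (coordv p) =
  \sum_k riem_component g i j l k x * g x k p.
Proof.
move=> /metric_derivable_christoffel dG; rewrite /R4 /lower inner_coordvr.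
by apply: eq_bigr => k _; rewrite riem_coordv.
Qed.

Lemma R4_skew12 x X Y Z W : R4 g x X Y Z W = - R4 g x Y X Z W.
Proof. by rewrite /R4 /lower riem_skew innerNl. Qed.

Lemma R4_skew34 x X Y Z W : U x -> R4 g x X Y Z W = - R4 g x X Y W Z.
Proof.
have aux (k a b c d : R) : k * a + b + (k * c + d) = k * (a + c) + (b + d) by ring.
move=> Ux; apply/eqP; rewrite -addr_eq0; apply/eqP; move: X.
apply: linear_ext => [*|i]; first by rewrite !R4_linear1// aux.
move: Y; apply: linear_ext => [*|j]; first by rewrite !R4_linear2// aux.
move: Z; apply: linear_ext => [*|l]; first by rewrite !(R4_linear3, R4_linear4)// aux.
move: W; apply: linear_ext => [*|p]; first by rewrite !(R4_linear3, R4_linear4)// aux.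
by rewrite !R4_coordv// (riem_component_skew34 x i j l p)// addNr.
Qed.

Lemma R4_bianchi x X Y Z W : U x ->
  R4 g x X Y Z W + R4 g x Y Z X W + R4 g x Z X Y W = 0.
Proof.
have aux (k a b c d e f : R) :
  k * a + b + (k * c + d) + (k * e + f) = k * (a + c + e) + (b + d + f) by ring.
move=> Ux; move: X; apply: linear_ext => [*|i].
  by rewrite !(R4_linear1, R4_linear2, R4_linear3)// aux.
move: Y; apply: linear_ext => [*|j].
  by rewrite !(R4_linear1, R4_linear2, R4_linear3)// aux.
move: Z; apply: linear_ext => [*|l].
  by rewrite !(R4_linear1, R4_linear2, R4_linear3)// aux.
move: W; apply: linear_ext => [*|p]; first by rewrite !R4_linear4 aux.
rewrite !R4_coordv// -!big_split big1// => k _ /=.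
by rewrite -!mulrDl riem_component_bianchi// mul0r.
Qed.

(** The classical argument: four Bianchi identities, one for each vector kept in the last slot,
    combined through the two skew symmetries. With [R4] abstracted to [T] this is linear
    arithmetic. *)
Lemma R4_pair x X Y Z W : U x -> R4 g x X Y Z W = R4 g x Z W X Y.
Proof.
move=> Ux.
have b1 := R4_bianchi x X Y Z W Ux; have b2 := R4_bianchi x Y Z W X Ux.
have b3 := R4_bianchi x Z W X Y Ux; have b4 := R4_bianchi x W X Y Z Ux.
have s12 := R4_skew12 x; have s34 X1 X2 X3 X4 := R4_skew34 x X1 X2 X3 X4 Ux.
have h1 := s34 X Y Z W; have h2 := s34 Z W X Y; have h3 := s12 Z W X Y.
have h4 := s12 X Y W Z; have h5 := s34 Y Z X W; have h6 := s34 Z X Y W.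
have h7 := s12 Y Z W X; have h8 := s12 Z W Y X; have h9 := s34 W Y Z X.
have h10 := s12 W X Z Y; have h11 := s34 X Z W Y; have h12 := s34 W X Y Z.
have h13 := s12 X Z W Y; have h14 := s12 W Y X Z; have h15 := s34 Y W X Z.
have h16 := s12 X Y Z W; have h17 := s34 W Y X Z; have h18 := s12 Y W X Z.
clear s12 s34.
move: (R4 g x) b1 b2 b3 b4 h1 h2 h3 h4 h5 h6 h7 h8 h9 h10 h11 h12 h13 h14 h15 h16 h17 h18.
move=> T; lra.
Qed.

End MetricCurvature.

(** * The Ricci tensor and its operator in coordinates *)

Section Ricci.
Context {R : realType} {n : nat}.
Local Notation V := 'rV[R]_n.

Lemma linear_coordv (f : V -> R) : (forall k X Y, f (k *: X + Y) = k * f X + f Y) ->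
  forall X, f X = \sum_i X 0 i * f (coordv i).
Proof.
move=> lf X; apply/eqP; rewrite -subr_eq0; apply/eqP; move: X.
apply: linear_ext => [k X Y|i].
  rewrite lf -[X in _ = k * (_ - X) + _]/(_) mulrBr mulr_sumr addrACA -opprD.
  congr (_ - _); rewrite -big_split; apply: eq_bigr => i _.
  by rewrite !mxE mulrDl mulrA.
rewrite (bigD1 i)//= coordvE eqxx mul1r big1 ?addr0 ?subrr// => j ji.
by rewrite coordvE (negbTE ji) mul0r.
Qed.

Lemma innerE (A : 'M[R]_n) (X Y : V) : inner A X Y = \sum_i \sum_j X 0 i * Y 0 j * A i j.
Proof.
rewrite /inner [LHS]mxE exchange_big; apply: eq_bigr => j _ /=.
rewrite [X in X * _]mxE [X in _ * X]mxE mulr_suml; apply: eq_bigr => i _.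
by rewrite mulrAC.
Qed.

Lemma inner_coordv (A : 'M[R]_n) i j : inner A (coordv i) (coordv j) = A i j.
Proof.
rewrite inner_coordvr (bigD1 i)//= coordvE eqxx mul1r big1 ?addr0// => k ki.
by rewrite coordvE (negbTE ki) mul0r.
Qed.

Variable g : V -> 'M[R]_n.

Lemma riem_scale1 k X Y Z x : derivable_christoffel g x ->
  riem g x (k *: X) Y Z = k *: riem g x X Y Z.
Proof.
move=> dG; have := riem_linear1 g (-1) 0 0 Y Z x dG.
rewrite scaler0 addr0 scaleN1r addNr => r0.
have := riem_linear1 g k X 0 Y Z x dG.
by rewrite (addr0 (k *: X)) r0 (addr0 (k *: riem g x X Y Z)).
Qed.

Lemma riem_add1 X X' Y Z x : derivable_christoffel g x ->
  riem g x (X + X') Y Z = riem g x X Y Z + riem g x X' Y Z.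
Proof.
move=> dG; have := riem_linear1 g 1 X X' Y Z x dG.
by rewrite (scale1r X) (scale1r (riem g x X Y Z)).
Qed.

Lemma ricciE x X Y : ricci g x X Y = \sum_i riem g x (coordv i) X Y 0 i.
Proof. by apply: eq_bigr => i _; rewrite mxE. Qed.

Lemma ricci_linear1 x k X X' Y : derivable_christoffel g x ->
  ricci g x (k *: X + X') Y = k * ricci g x X Y + ricci g x X' Y.
Proof.
move=> dG; rewrite !ricciE mulr_sumr -big_split; apply: eq_bigr => i _.
by rewrite riem_linear2// [LHS]mxE [X in X + _ = _]mxE.
Qed.

Lemma ricci_linear2 x k X Y Y' : derivable_christoffel g x ->
  ricci g x X (k *: Y + Y') = k * ricci g x X Y + ricci g x X Y'.
Proof.
move=> dG; rewrite !ricciE mulr_sumr -big_split; apply: eq_bigr => i _.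
by rewrite riem_linear3// [LHS]mxE [X in X + _ = _]mxE.
Qed.

Lemma ricci_inner_mx x X Y : derivable_christoffel g x ->
  ricci g x X Y = inner (ricci_mx g x) X Y.
Proof.
move=> dG; rewrite innerE.
rewrite (linear_coordv (fun X => ricci g x X Y)) => [|k X1 X2]; last exact: ricci_linear1.
apply: eq_bigr => i _.
rewrite (linear_coordv (ricci g x (coordv i))) => [|k X1 X2]; last exact: ricci_linear2.
rewrite mulr_sumr; apply: eq_bigr => j _.
by rewrite mulrA; congr (_ * _); rewrite mxE.
Qed.

Lemma ricci_inner x X Y : derivable_christoffel g x -> g x \in unitmx ->
  ricci g x X Y = inner (g x) (X *m ricci_op_mx g x) Y.
Proof.
move=> dG gu; rewrite ricci_inner_mx// /inner /ricci_op_mx.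
by rewrite [in RHS]mulmxA (mulmxKV gu).
Qed.

(** Raising an index; it rewrites the trace defining the Ricci tensor as a metric contraction of
    [R4]. *)
Lemma inner_invmx (A : 'M[R]_n) (X : V) i : A \in unitmx ->
  X 0 i = \sum_p inner A X (coordv p) * invmx A p i.
Proof.
move=> Au; have : X 0 i = (X *m A *m invmx A) 0 i by rewrite mulmxK.
move=> ->; rewrite [LHS]mxE; apply: eq_bigr => p _; congr (_ * _).
by rewrite inner_coordvr mxE.
Qed.

(** Pair symmetry and the two skew symmetries give R(e_i, X, Y, e_p) = R(e_p, Y, X, e_i), and the
    inverse metric used to contract [i] with [p] is symmetric. *)
Lemma ricci_sym (U : set V) x X Y : metric_on U g -> U x ->
  ricci g x X Y = ricci g x Y X.
Proof.
move=> gU Ux; have [_ gS gu _] := gU.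
have invS i p : invmx (g x) i p = invmx (g x) p i.
  have : (invmx (g x))^T = invmx (g x) by rewrite trmx_inv gS.
  by move=> /matrixP/(_ i p) <-; rewrite [LHS]mxE.
rewrite !ricciE.
under eq_bigr do rewrite (inner_invmx (g x)) ?gu//.
under [RHS]eq_bigr do rewrite (inner_invmx (g x)) ?gu//.
rewrite [RHS]exchange_big; apply: eq_bigr => i _; apply: eq_bigr => p _ /=.
rewrite invS; congr (_ * _).
rewrite -[RHS]/(R4 g x (coordv p) Y X (coordv i)) -[LHS]/(R4 g x (coordv i) X Y (coordv p)).
rewrite (R4_pair _ _ gU _ _ _ _ _ Ux) R4_skew12 (R4_skew34 _ _ gU _ _ _ _ _ Ux).
exact: opprK.
Qed.

End Ricci.

(** * Warped products over a line *)

Lemma partial_cst {R : realType} n i (k : R) (x : 'rV[R]_n) : partial i (fun=> k) x = 0.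
Proof. exact: derive_cst. Qed.

Section ProductCoordinates.
Context {R : realType} {n1 n2 : nat}.
Implicit Types (z : 'rV[R]_(n1 + n2)) (psi : 'rV[R]_(n1 + n2) -> R).

Lemma coordv_lshift i : coordv (lshift n2 i) = row_mx (coordv i) 0 :> 'rV[R]_(n1 + n2).
Proof.
apply/rowP => j; rewrite coordvE mxE.
by case: split_ordP => k ->; rewrite ?coordvE ?mxE eq_shift.
Qed.

Lemma coordv_rshift i : coordv (rshift n1 i) = row_mx 0 (coordv i) :> 'rV[R]_(n1 + n2).
Proof.
apply/rowP => j; rewrite coordvE mxE.
by case: split_ordP => k ->; rewrite ?coordvE ?mxE eq_shift.
Qed.

Lemma partial_lshift psi i z : partial (lshift n2 i) psi z =
  partial i (fun t => psi (row_mx t (rsubmx z))) (lsubmx z).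
Proof.
rewrite /partial /derive; set q := (X in _ = lim (X @ _)).
rewrite (_ : (fun h => _) = q)//; apply/funext => h.
rewrite /q /shift/= hsubmxK coordv_lshift scale_row_mx scaler0.
by rewrite -[X in psi (_ + X)]hsubmxK add_row_mx add0r.
Qed.

Lemma partial_rshift psi i z : partial (rshift n1 i) psi z =
  partial i (fun x => psi (row_mx (lsubmx z) x)) (rsubmx z).
Proof.
rewrite /partial /derive; set q := (X in _ = lim (X @ _)).
rewrite (_ : (fun h => _) = q)//; apply/funext => h.
rewrite /q /shift/= hsubmxK coordv_rshift scale_row_mx scaler0.
by rewrite -[X in psi (_ + X)]hsubmxK add_row_mx add0r.
Qed.

Lemma derivable_lsubmx (u : 'rV[R]_n1 -> R) z v :
  derivable u (lsubmx z) (lsubmx v) -> derivable (fun y => u (lsubmx y)) z v.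
Proof.
rewrite /derivable; set q := (X in cvg (X @ _)) => cq.
rewrite (_ : (fun h => _) = q)//; apply/funext => h.
by rewrite /q /shift/=; congr (_ *: (u _ - _)); apply/rowP => j; rewrite !mxE.
Qed.

Lemma derivable_rsubmx (u : 'rV[R]_n2 -> R) z v :
  derivable u (rsubmx z) (rsubmx v) -> derivable (fun y => u (rsubmx y)) z v.
Proof.
rewrite /derivable; set q := (X in cvg (X @ _)) => cq.
rewrite (_ : (fun h => _) = q)//; apply/funext => h.
by rewrite /q /shift/=; congr (_ *: (u _ - _)); apply/rowP => j; rewrite !mxE.
Qed.

Lemma partial_lshift_l (u : 'rV[R]_n1 -> R) i z :
  partial (lshift n2 i) (fun y => u (lsubmx y)) z = partial i u (lsubmx z).
Proof.
rewrite partial_lshift; congr (partial _ _ _).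
by apply/funext => t; rewrite row_mxKl.
Qed.

Lemma partial_rshift_r (u : 'rV[R]_n2 -> R) i z :
  partial (rshift n1 i) (fun y => u (rsubmx y)) z = partial i u (rsubmx z).
Proof.
rewrite partial_rshift; congr (partial _ _ _).
by apply/funext => t; rewrite row_mxKr.
Qed.

Lemma partial_rshift_l (u : 'rV[R]_n1 -> R) i z :
  partial (rshift n1 i) (fun y => u (lsubmx y)) z = 0.
Proof.
rewrite partial_rshift; under [X in partial _ X]eq_fun do rewrite row_mxKl.
exact: partial_cst.
Qed.

Lemma partial_lshift_r (u : 'rV[R]_n2 -> R) i z :
  partial (lshift n2 i) (fun y => u (rsubmx y)) z = 0.
Proof.
rewrite partial_lshift; under [X in partial _ X]eq_fun do rewrite row_mxKr.
exact: derive_cst.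
Qed.

Lemma partial_lshift_lr (u : 'rV[R]_n1 -> R) (v : 'rV[R]_n2 -> R) i z :
  derivable u (lsubmx z) (coordv i) ->
  partial (lshift n2 i) (fun y => u (lsubmx y) * v (rsubmx y)) z =
  partial i u (lsubmx z) * v (rsubmx z).
Proof.
move=> du; rewrite partial_lshift.
under [X in partial _ X]eq_fun do rewrite row_mxKl row_mxKr.
exact: derive_mulC.
Qed.

Lemma partial_rshift_lr (u : 'rV[R]_n1 -> R) (v : 'rV[R]_n2 -> R) i z :
  derivable v (rsubmx z) (coordv i) ->
  partial (rshift n1 i) (fun y => u (lsubmx y) * v (rsubmx y)) z =
  u (lsubmx z) * partial i v (rsubmx z).
Proof.
move=> dv; rewrite partial_rshift.
under [X in partial _ X]eq_fun do rewrite row_mxKl row_mxKr mulrC.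
by rewrite mulrC; exact: derive_mulC.
Qed.

(** Formulas valid over the two chart images thereby hold on a neighbourhood of [z], as needed to
    differentiate them. *)
Lemma near_submx (A : set 'rV[R]_n1) (B : set 'rV[R]_n2) z :
  open A -> open B -> A (lsubmx z) -> B (rsubmx z) ->
  \forall y \near z, A (lsubmx y) /\ B (rsubmx y).
Proof.
move=> oA oB Az Bz.
near=> y; split; near: y; [apply: continuous_lsubmx|apply: continuous_rsubmx]; exact: open_nbhs_nbhs.
Unshelve. all: by end_near.
Qed.

End ProductCoordinates.

(** * Christoffel symbols and curvature of a warped product with one-dimensional base *)

Section WarpedProduct.
Context {R : realType} {m : nat}.
Local Notation base := ('rV[R]_1).
Local Notation fiber := ('rV[R]_m).

Definition warped (P : base -> 'M[R]_1) (q : base -> R) (G : fiber -> 'M[R]_m)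
    (z : 'rV[R]_(1 + m)) : 'M[R]_(1 + m) :=
  block_mx (P (lsubmx z)) 0 0 (q (lsubmx z) *: G (rsubmx z)).

Variables (W : set base) (U : set fiber).
Variables (P : base -> 'M[R]_1) (q : base -> R) (G : fiber -> 'M[R]_m).
(** With 0 for the base index, the nonzero symbols involving it will be Gamma^0_00 = [alpha],
    Gamma^k_0j = Gamma^k_j0 = [beta] delta_jk and Gamma^0_ij = [gamma] G_ij. [partial_p],
    [partial_q] and [gammaE] are the equations determining these three functions. *)
Variables (alpha beta gamma : base -> R) (c : R).
Local Notation p := (fun t => P t 0 0).

Hypotheses (oW : open W) (GU : metric_on U G).
Hypothesis p_neq0 : forall t, W t -> P t 0 0 != 0.
Hypothesis q_neq0 : forall t, W t -> q t != 0.
Hypothesis dq : forall t v, W t -> derivable q t v.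
Hypothesis dalpha : forall t v, W t -> derivable alpha t v.
Hypothesis dbeta : forall t v, W t -> derivable beta t v.
Hypothesis dgamma : forall t v, W t -> derivable gamma t v.
Hypothesis partial_p : forall t, W t -> partial 0 p t = 2 * P t 0 0 * alpha t.
Hypothesis partial_q : forall t, W t -> partial 0 q t = 2 * q t * beta t.
Hypothesis gammaE : forall t, W t -> gamma t * P t 0 0 = - (beta t * q t).
(** [partial_beta] and [partial_gamma] express the vanishing of the curvature in mixed base and
    fiber directions, that is h'' = 0 with respect to x^1. [beta_gamma] fixes the amount [c] by
    which the fiber curvature is shifted. *)
Hypothesis partial_beta : forall t, W t ->
  partial 0 beta t + beta t * beta t - alpha t * beta t = 0.
Hypothesis partial_gamma : forall t, W t ->
  partial 0 gamma t + alpha t * gamma t - beta t * gamma t = 0.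
Hypothesis beta_gamma : forall t, W t -> beta t * gamma t = - c.

Local Notation g := (warped P q G).
Local Notation O := (lshift m (0 : 'I_1)).
Local Notation r := (rshift 1).

Lemma warped_OO y : g y O O = P (lsubmx y) 0 0.
Proof. exact: block_mxEul. Qed.

Lemma warped_Or y k : g y O (r k) = 0.
Proof. by rewrite [LHS]block_mxEur mxE. Qed.

Lemma warped_rO y k : g y (r k) O = 0.
Proof. by rewrite [LHS]block_mxEdl mxE. Qed.

Lemma warped_rr y k l : g y (r k) (r l) = q (lsubmx y) * G (rsubmx y) k l.
Proof. by rewrite [LHS]block_mxEdr mxE. Qed.

Section AtPoint.
Variable z : 'rV[R]_(1 + m).
Hypotheses (Wz : W (lsubmx z)) (Uz : U (rsubmx z)).

Lemma derivable_fiber k l i : derivable (fun x => G x k l) (rsubmx z) (coordv i).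
Proof.
have [_ _ _ GC] := GU.
by apply: diff_derivable; case: (GC k l 1) => df _; exact: df.
Qed.

Lemma partial_OO : partial O (fun y => g y O O) z = 2 * P (lsubmx z) 0 0 * alpha (lsubmx z).
Proof.
under [X in partial _ X]eq_fun do rewrite warped_OO.
by rewrite (partial_lshift_l p) partial_p.
Qed.

Lemma partial_rOO i : partial (r i) (fun y => g y O O) z = 0.
Proof.
under [X in partial _ X]eq_fun do rewrite warped_OO.
exact: (partial_rshift_l p).
Qed.

Lemma partial_Or k i : partial i (fun y => g y O (r k)) z = 0.
Proof. by under [X in partial _ X]eq_fun do rewrite warped_Or; exact: derive_cst. Qed.

Lemma partial_rO k i : partial i (fun y => g y (r k) O) z = 0.
Proof. by under [X in partial _ X]eq_fun do rewrite warped_rO; exact: derive_cst. Qed.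

Lemma partial_Orr k l : partial O (fun y => g y (r k) (r l)) z =
  2 * q (lsubmx z) * beta (lsubmx z) * G (rsubmx z) k l.
Proof.
under [X in partial _ X]eq_fun do rewrite warped_rr.
by rewrite (partial_lshift_lr q (fun x => G x k l)) ?partial_q//; exact: dq.
Qed.

Lemma partial_rrr i k l : partial (r i) (fun y => g y (r k) (r l)) z =
  q (lsubmx z) * partial i (fun x => G x k l) (rsubmx z).
Proof.
under [X in partial _ X]eq_fun do rewrite warped_rr.
rewrite (partial_rshift_lr q (fun x => G x k l))//; exact: derivable_fiber.
Qed.

Lemma invmx_warped : invmx (g z) =
  block_mx (P (lsubmx z) 0 0)^-1%:M 0 0 ((q (lsubmx z))^-1 *: invmx (G (rsubmx z))).
Proof.
have [_ _ Gu _] := GU.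
have qG : q (lsubmx z) *: G (rsubmx z) \in unitmx.
  by rewrite unitmxZ ?Gu// unitfE q_neq0.
rewrite /warped invmx_block_diag.
  by rewrite [P _]mx11_scalar invmx_scalar invmxZ// !mxE eqxx.
rewrite block_diag_mx_unit qG andbT unitmxE det_mx11 unitfE; exact: p_neq0.
Qed.

Lemma invmx_OO : invmx (g z) O O = (P (lsubmx z) 0 0)^-1.
Proof. by rewrite invmx_warped [LHS]block_mxEul mxE. Qed.

Lemma invmx_Or k : invmx (g z) O (r k) = 0.
Proof. by rewrite invmx_warped [LHS]block_mxEur mxE. Qed.

Lemma invmx_rO k : invmx (g z) (r k) O = 0.
Proof. by rewrite invmx_warped [LHS]block_mxEdl mxE. Qed.

Lemma invmx_rr k l : invmx (g z) (r k) (r l) =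
  (q (lsubmx z))^-1 * invmx (G (rsubmx z)) k l.
Proof. by rewrite invmx_warped [LHS]block_mxEdr mxE. Qed.

Lemma christoffel_baseE i j : christoffel g i j O z =
  2^-1 * (P (lsubmx z) 0 0)^-1 *
    (partial i (fun y => g y j O) z + partial j (fun y => g y i O) z
     - partial O (fun y => g y i j) z).
Proof.
rewrite /christoffel big_split_ord big_ord1 /= invmx_OO.
rewrite big1 ?addr0 ?mulrA// => l _.
by rewrite invmx_Or mul0r.
Qed.

Lemma christoffel_fiberE i j k : christoffel g i j (r k) z =
  2^-1 * \sum_l (q (lsubmx z))^-1 * invmx (G (rsubmx z)) k l *
    (partial i (fun y => g y j (r l)) z + partial j (fun y => g y i (r l)) z
     - partial (r l) (fun y => g y i j) z).
Proof.
rewrite /christoffel big_split_ord big_ord1 /= invmx_rO mul0r add0r.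
by congr (_ * _); apply: eq_bigr => l _; rewrite invmx_rr.
Qed.

Lemma invmx_fiberK k j :
  \sum_l invmx (G (rsubmx z)) k l * G (rsubmx z) j l = (j == k)%:R.
Proof.
have [_ GS Gu _] := GU.
have /matrixP/(_ k j) := mulVmx (Gu _ Uz); rewrite [LHS]mxE [RHS]mxE eq_sym => <-.
by apply: eq_bigr => l _; congr (_ * _); rewrite -[in LHS](GS _ Uz) mxE.
Qed.

Lemma christoffel_OOO : christoffel g O O O z = alpha (lsubmx z).
Proof.
rewrite christoffel_baseE partial_OO; have := p_neq0 _ Wz.
by move: (P _ _ _) (alpha _) => x y x0; field.
Qed.

Lemma christoffel_OrO j : christoffel g O (r j) O z = 0.
Proof. by rewrite christoffel_baseE partial_rO partial_rOO partial_Or; ring. Qed.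

Lemma christoffel_rOO j : christoffel g (r j) O O z = 0.
Proof. by rewrite christoffel_baseE partial_rO partial_rOO; ring. Qed.

Lemma christoffel_rrO i j : christoffel g (r i) (r j) O z =
  gamma (lsubmx z) * G (rsubmx z) i j.
Proof.
rewrite christoffel_baseE !partial_rO partial_Orr.
have := p_neq0 _ Wz; have := gammaE _ Wz.
move: (P _ _ _) (beta _) (q _) (gamma _) (G _ _ _) => x y s t u e x0.
(* [gammaE] is used from right to left: [beta * q] is traded for [- (gamma * p)], and the factor [p]
   cancels. *)
by rewrite -[2 * s * y]mulrA [s * y]mulrC -[y * s]opprK -e; field.
Qed.

Lemma christoffel_OOr k : christoffel g O O (r k) z = 0.
Proof.
rewrite christoffel_fiberE big1 ?mulr0// => l _.
by rewrite !partial_Or partial_rOO; ring.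
Qed.

Lemma christoffel_Orr j k : christoffel g O (r j) (r k) z =
  beta (lsubmx z) * (j == k)%:R.
Proof.
rewrite christoffel_fiberE -invmx_fiberK !mulr_sumr; apply: eq_bigr => l _.
rewrite !partial_Or partial_Orr; have := q_neq0 _ Wz.
by move: (q _) (beta _) (G _ _ _) (invmx _ _ _) => x y u v x0; field.
Qed.

Lemma christoffel_rOr j k : christoffel g (r j) O (r k) z =
  beta (lsubmx z) * (j == k)%:R.
Proof.
rewrite christoffel_fiberE -invmx_fiberK !mulr_sumr; apply: eq_bigr => l _.
rewrite !partial_Or partial_rO partial_Orr; have := q_neq0 _ Wz.
by move: (q _) (beta _) (G _ _ _) (invmx _ _ _) => x y u v x0; field.
Qed.

Lemma christoffel_rrr i j k : christoffel g (r i) (r j) (r k) z =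
  christoffel G i j k (rsubmx z).
Proof.
rewrite christoffel_fiberE /christoffel; congr (_ * _); apply: eq_bigr => l _.
rewrite !partial_rrr; have := q_neq0 _ Wz.
move: (q _) (invmx _ _ _) (partial _ _ _) (partial _ _ _) (partial _ _ _).
by move=> x v s t u x0; field.
Qed.

End AtPoint.

Lemma sum_delta (F : 'I_m -> R) k : \sum_i F i * (i == k)%:R = F k.
Proof.
rewrite (bigD1 k)//= eqxx mulr1 big1 ?addr0// => i ik.
by rewrite (negbTE ik) mulr0.
Qed.

Lemma sum_delta_sym (F : 'I_m -> R) k : \sum_i F i * (k == i)%:R = F k.
Proof. by rewrite -[RHS]sum_delta; apply: eq_bigr => i _; rewrite eq_sym. Qed.

Section CurvatureAtPoint.
Variable z : 'rV[R]_(1 + m).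
Hypotheses (Wz : W (lsubmx z)) (Uz : U (rsubmx z)).

Lemma near_christoffel i j k (u : 'rV[R]_(1 + m) -> R) :
  (forall y, W (lsubmx y) -> U (rsubmx y) -> christoffel g i j k y = u y) ->
  \forall y \near z, christoffel g i j k y = u y.
Proof.
move=> E; have [oU _ _ _] := GU; near=> y.
have [Wy Uy] : W (lsubmx y) /\ U (rsubmx y) by near: y; exact: near_submx.
exact: E.
Unshelve. all: by end_near.
Qed.

Lemma partial_christoffel s i j k (u : 'rV[R]_(1 + m) -> R) :
  (forall y, W (lsubmx y) -> U (rsubmx y) -> christoffel g i j k y = u y) ->
  partial s (christoffel g i j k) z = partial s u z.
Proof. by move=> /near_christoffel E; exact: near_eq_derive. Qed.

Lemma derivable_christoffel_near i j k v (u : 'rV[R]_(1 + m) -> R) :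
  (forall y, W (lsubmx y) -> U (rsubmx y) -> christoffel g i j k y = u y) ->
  derivable u z v -> derivable (christoffel g i j k) z v.
Proof.
move=> /near_christoffel E; apply: near_eq_derivable.
by near=> y; apply/esym; near: y.
Unshelve. all: by end_near.
Qed.

(** Each symbol agrees near [z] with one of the explicit formulas, whose derivability is clear. *)
Lemma derivable_christoffel_warped : derivable_christoffel g z.
Proof.
have [_ _ _ GC] := GU.
have dl (u : base -> R) v : (forall t w, W t -> derivable u t w) ->
    derivable (fun y : 'rV[R]_(1 + m) => u (lsubmx y)) z v.
  by move=> du; apply: derivable_lsubmx; exact: du.
move=> i j k v.
case: (split_ordP i) => {}i ->; case: (split_ordP j) => {}j ->;
  case: (split_ordP k) => {}k ->; rewrite ?ord1.
- apply: (derivable_christoffel_near _ _ _ _ _ christoffel_OOO); exact: dl.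
- apply: (derivable_christoffel_near _ _ _ _ _ (fun y Wy Uy => christoffel_OOr y Wy Uy k)).
  exact: derivable_cst.
- apply: (derivable_christoffel_near _ _ _ _ _ (fun y Wy Uy => christoffel_OrO y Wy Uy j)).
  exact: derivable_cst.
- apply: (derivable_christoffel_near _ _ _ _ _ (fun y Wy Uy => christoffel_Orr y Wy Uy j k)).
  by apply: derivable_mulC; exact: dl.
- apply: (derivable_christoffel_near _ _ _ _ _ (fun y Wy Uy => christoffel_rOO y Wy Uy i)).
  exact: derivable_cst.
- apply: (derivable_christoffel_near _ _ _ _ _ (fun y Wy Uy => christoffel_rOr y Wy Uy i k)).
  by apply: derivable_mulC; exact: dl.
- apply: (derivable_christoffel_near _ _ _ _ _ (fun y Wy Uy => christoffel_rrO y Wy Uy i j)).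
  apply: derivableM; first exact: dl.
  apply: (derivable_rsubmx (fun x => G x i j)).
  by apply: diff_derivable; case: (GC i j 1) => df _; exact: df.
- apply: (derivable_christoffel_near _ _ _ _ _ (fun y Wy Uy => christoffel_rrr y Wy Uy i j k)).
  apply: derivable_rsubmx; exact: (metric_derivable_christoffel _ _ GU).
Qed.

Lemma riem_component_same i l k : riem_component g i i l k z = 0.
Proof. by rewrite /riem_component subrr add0r big1// => s _; rewrite subrr. Qed.

Lemma riem_component_skew i j l k :
  riem_component g i j l k z = - riem_component g j i l k z.
Proof.
rewrite /riem_component !sumrB.
move: (partial i _ _) (partial j _ _) (\sum_s _) (\sum_s _) => *; ring.
Qed.

(** [partial_beta] settles the fiber component on the base vector, [partial_gamma] the base
    component on a fiber vector. In the remaining two cases the terms vanish or cancel without these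
    equations. *)
Lemma riem_component_Or j l k : riem_component g O (r j) l k z = 0.
Proof.
rewrite /riem_component big_split_ord big_ord1 /=.
case: (split_ordP l) => {}l ->; case: (split_ordP k) => {}k ->; rewrite ?ord1.
- rewrite (partial_christoffel O _ _ _ _ (fun y Wy Uy => christoffel_rOO y Wy Uy j)).
  rewrite (partial_christoffel (r j) _ _ _ _ christoffel_OOO) partial_rshift_l.
  rewrite partial_cst christoffel_rOO// mulr0 mul0r big1 => [|s _].
    by rewrite !subr0 !addr0.
  by rewrite christoffel_OrO// christoffel_OOr// mul0r mulr0 subr0.
- rewrite (partial_christoffel O _ _ _ _ (fun y Wy Uy => christoffel_rOr y Wy Uy j k)).
  rewrite (partial_christoffel (r j) _ _ _ _ (fun y Wy Uy => christoffel_OOr y Wy Uy k)).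
  rewrite partial_cst subr0 christoffel_rOO// christoffel_rOr//.
  rewrite christoffel_OOO//.
  rewrite (partial_lshift_lr beta (fun=> (j == k)%:R)); last exact: dbeta.
  under eq_bigr do rewrite christoffel_Orr// christoffel_rOr// christoffel_OOr//
    mulr0 subr0 mulrA.
  rewrite sum_delta_sym mulr0 sub0r.
  have := partial_beta _ Wz; move: (partial _ _ _) (alpha _) (beta _) (_ == _) => x y s d e.
  (* The 0 on the right becomes a multiple of the left side of [partial_beta], which leaves a ring
     identity. *)
  by rewrite -(mulr0 d%:R) -e; ring.
- rewrite (partial_christoffel O _ _ _ _ (fun y Wy Uy => christoffel_rrO y Wy Uy j l)).
  rewrite (partial_christoffel (r j) _ _ _ _ (fun y Wy Uy => christoffel_OrO y Wy Uy l)).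
  rewrite partial_cst subr0 christoffel_OOO// christoffel_rrO//.
  rewrite christoffel_rOO// mul0r subr0.
  rewrite (partial_lshift_lr gamma (fun x => G x j l)); last exact: dgamma.
  under eq_bigr do rewrite christoffel_OrO// mul0r sub0r christoffel_rrO//
    christoffel_Orr// mulrA -mulNr.
  rewrite sum_delta_sym.
  have := partial_gamma _ Wz; move: (partial _ _ _) (alpha _) (beta _) (gamma _) (G _ _ _).
  by move=> x y s t u e; rewrite -(mulr0 u) -e; ring.
- rewrite (partial_christoffel O _ _ _ _ (fun y Wy Uy => christoffel_rrr y Wy Uy j l k)).
  rewrite (partial_christoffel (r j) _ _ _ _ (fun y Wy Uy => christoffel_Orr y Wy Uy l k)).
  rewrite partial_lshift_r (partial_rshift_lr beta (fun=> (l == k)%:R)) => //.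
  rewrite partial_cst mulr0 subr0 add0r christoffel_OOr//.
  rewrite christoffel_OrO// mul0r mulr0 subr0 add0r.
  under eq_bigr do rewrite christoffel_Orr// christoffel_rrr// christoffel_rrr//
    christoffel_Orr// mulrAC mulrA.
  by rewrite sumrB sum_delta sum_delta_sym mulrC subrr.
Qed.

Lemma Gsym k l : G (rsubmx z) k l = G (rsubmx z) l k.
Proof. by have [_ GS _ _] := GU; rewrite -[in LHS](GS _ Uz) mxE. Qed.

(** The Codazzi equation: the second fundamental form of a fiber is a multiple, constant along it,
    of the fiber metric, which is parallel. *)
Lemma riem_component_rrO i j l : riem_component g (r i) (r j) l O z = 0.
Proof.
have [oU _ _ _] := GU.
have cS s t k : christoffel G s t k (rsubmx z) = christoffel G t s k (rsubmx z).
  by apply: christoffel_symmetric; exact: (metric_near_sym _ _ GU _ Uz).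
rewrite /riem_component big_split_ord big_ord1 /=.
case: (split_ordP l) => {}l ->; rewrite ?ord1.
- rewrite (partial_christoffel (r i) _ _ _ _ (fun y Wy Uy => christoffel_rOO y Wy Uy j)).
  rewrite (partial_christoffel (r j) _ _ _ _ (fun y Wy Uy => christoffel_rOO y Wy Uy i)).
  rewrite !partial_cst !christoffel_rOO// !mul0r !subr0 !add0r.
  under eq_bigr do rewrite !christoffel_rrO// !christoffel_rOr// !mulrA.
  by rewrite sumrB !sum_delta_sym (Gsym j i) subrr.
- rewrite (partial_christoffel (r i) _ _ _ _ (fun y Wy Uy => christoffel_rrO y Wy Uy j l)).
  rewrite (partial_christoffel (r j) _ _ _ _ (fun y Wy Uy => christoffel_rrO y Wy Uy i l)).
  rewrite (partial_rshift_lr gamma (fun x => G x j l)); last exact: derivable_fiber.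
  rewrite (partial_rshift_lr gamma (fun x => G x i l)); last exact: derivable_fiber.
  rewrite !christoffel_rOO// !mul0r !subr0 !add0r.
  under eq_bigr do rewrite !christoffel_rrO// !christoffel_rrr// -!mulrA -mulrBr.
  rewrite -mulr_sumr sumrB -!mulrBr -mulrDr.
  rewrite (partial_metric _ _ GU _ i j l Uz) (partial_metric _ _ GU _ j i l Uz).
  have low a b d : \sum_k G (rsubmx z) a k * christoffel G b d k (rsubmx z) =
      christoffel_lower G b d a (rsubmx z).
    apply: eq_bigr => k _; by rewrite mulrC Gsym.
  rewrite !low (_ : christoffel_lower G j i l _ = christoffel_lower G i j l (rsubmx z)).
    move: (christoffel_lower _ _ _ _ _) (christoffel_lower _ _ _ _ _).
    by move: (christoffel_lower _ _ _ _ _) (gamma _) => *; ring.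
  by apply: eq_bigr => k _; rewrite cS.
Qed.

(** The Gauss equation: the base index in the quadratic sum contributes [beta * gamma = - c] times
    the metric wedge. *)
Lemma riem_component_rrr i j l k : riem_component g (r i) (r j) (r l) (r k) z =
  riem_component G i j l k (rsubmx z) -
  c * (G (rsubmx z) j l * (i == k)%:R - G (rsubmx z) i l * (j == k)%:R).
Proof.
rewrite /riem_component big_split_ord big_ord1 /=.
rewrite (partial_christoffel (r i) _ _ _ _ (fun y Wy Uy => christoffel_rrr y Wy Uy j l k)).
rewrite (partial_christoffel (r j) _ _ _ _ (fun y Wy Uy => christoffel_rrr y Wy Uy i l k)).
rewrite !partial_rshift_r !christoffel_rOr// !christoffel_rrO//.
under eq_bigr do rewrite !christoffel_rrr//.
have := beta_gamma _ Wz.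
move: (partial i _ _) (partial j _ _) (\sum_s _) (beta _) (gamma _).
move: (G _ _ _) (G _ _ _) (i == k) (j == k) => G1 G2 d1 d2 x y s t u e.
by rewrite -[c]opprK -e; ring.
Qed.

Lemma riem_component_rrOr i j k : riem_component g (r i) (r j) O (r k) z = 0.
Proof.
have cS s t : christoffel G s t k (rsubmx z) = christoffel G t s k (rsubmx z).
  by apply: christoffel_symmetric; exact: (metric_near_sym _ _ GU _ Uz).
rewrite /riem_component big_split_ord big_ord1 /=.
rewrite (partial_christoffel (r i) _ _ _ _ (fun y Wy Uy => christoffel_rOr y Wy Uy j k)).
rewrite (partial_christoffel (r j) _ _ _ _ (fun y Wy Uy => christoffel_rOr y Wy Uy i k)).
rewrite (partial_rshift_lr beta (fun=> (j == k)%:R))//.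
rewrite (partial_rshift_lr beta (fun=> (i == k)%:R))//.
rewrite !partial_cst !mulr0 !christoffel_rOO// !mulr0 !subr0 !add0r.
under eq_bigr do rewrite !christoffel_rrr// !christoffel_rOr// !mulrA.
by rewrite sumrB !sum_delta_sym cS subrr.
Qed.

End CurvatureAtPoint.

Lemma riem_warped_base i j l k z : W (lsubmx z) -> U (rsubmx z) ->
  [\/ i = O, j = O, l = O | k = O] -> riem_component g i j l k z = 0.
Proof.
move=> Wz Uz; case: (split_ordP i) => {}i ->; rewrite ?ord1.
  case: (split_ordP j) => {}j -> _; rewrite ?ord1; first exact: riem_component_same.
  exact: riem_component_Or.
case: (split_ordP j) => {}j ->; rewrite ?ord1.
  by move=> _; rewrite riem_component_skew riem_component_Or ?oppr0.
case: (split_ordP k) => {}k ->; rewrite ?ord1.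
  by move=> _; exact: riem_component_rrO.
case: (split_ordP l) => {}l -> E; rewrite ?ord1; first exact: riem_component_rrOr.
by case: E => /eqP; rewrite eq_shift.
Qed.

(** The fiber part of the warped curvature, as given by the Gauss equation. *)
Definition fiber_curvature (x X Y Z : fiber) : fiber :=
  riem G x X Y Z - c *: wedge (inner (G x)) X Y Z.

Lemma fiber_curvatureE x X Y Z i : fiber_curvature x X Y Z 0 i = riem G x X Y Z 0 i
  - c * (inner (G x) Y Z * X 0 i - inner (G x) X Z * Y 0 i).
Proof.
rewrite [LHS]mxE [X in _ + X]mxE [X in _ - X]mxE; congr (_ - _ * _).
by rewrite !mxE.
Qed.

Lemma riem_warped z X Y Z : W (lsubmx z) -> U (rsubmx z) ->
  riem g z X Y Z =
  row_mx 0 (fiber_curvature (rsubmx z) (rsubmx X) (rsubmx Y) (rsubmx Z)).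
Proof.
move=> Wz Uz; have dg := derivable_christoffel_warped z Wz Uz.
have dG := metric_derivable_christoffel _ _ GU _ Uz.
apply/rowP => k; rewrite riemE//; case: (split_ordP k) => {}k ->; rewrite ?ord1.
  rewrite row_mxEl mxE; apply: big1 => i _; apply: big1 => j _; apply: big1 => l _.
  by rewrite riem_warped_base ?mulr0//; constructor.
rewrite row_mxEr big_split_ord big_ord1 /= big1 ?add0r => [|j _]; last first.
  by apply: big1 => l _; rewrite riem_warped_base ?mulr0//; constructor.
rewrite fiber_curvatureE [riem _ _ _ _ _ _ _]riemE// !innerE ![rsubmx _ 0 k]mxE.
have -> : \sum_(i < m) \sum_j \sum_l X 0 (r i) * Y 0 j * Z 0 l *
      riem_component g (r i) j l (r k) z =
    \sum_(i < m) \sum_(j < m) \sum_(l < m) X 0 (r i) * Y 0 (r j) * Z 0 (r l) *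
      riem_component g (r i) (r j) (r l) (r k) z.
  apply: eq_bigr => i _; rewrite big_split_ord big_ord1 /= big1 ?add0r => [|l _]; last first.
    by rewrite riem_warped_base ?mulr0//; constructor.
  apply: eq_bigr => j _; rewrite big_split_ord big_ord1 /=.
  by rewrite riem_warped_base ?mulr0 ?add0r//; constructor.
under eq_bigr => i _ do under eq_bigr => j _ do under eq_bigr => l _ do
  rewrite riem_component_rrr// mulrBr.
under eq_bigr => i _ do under eq_bigr => j _ do rewrite sumrB.
under eq_bigr => i _ do rewrite sumrB.
rewrite sumrB; congr (_ - _).
  by apply: eq_bigr => i _; apply: eq_bigr => j _; apply: eq_bigr => l _; rewrite !mxE.
pose B (V1 V2 : fiber) := \sum_i \sum_j V1 0 i * V2 0 j * G (rsubmx z) i j.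
have swap (x' y' w' u d : R) : x' * y' * w' * (c * (u * d)) = c * (y' * w' * u) * x' * d.
  by ring.
have swap' (x' y' w' u d : R) : x' * y' * w' * (c * (u * d)) = c * (x' * w' * u) * y' * d.
  by ring.
(* Each of the two wedge terms has a Kronecker delta that contracts one index; the other two form
   the metric pairing [B]. *)
transitivity (\sum_(i < m) c * B (rsubmx Y) (rsubmx Z) * X 0 (r i) * (i == k)%:R -
              \sum_(j < m) c * B (rsubmx X) (rsubmx Z) * Y 0 (r j) * (j == k)%:R).
  under eq_bigr => i _ do under eq_bigr => j _ do
    (under eq_bigr => l _ do rewrite mulrBr mulrBr; rewrite sumrB).
  under eq_bigr => i _ do rewrite sumrB.
  rewrite sumrB; congr (_ - _).
    apply: eq_bigr => i _; rewrite /B mulr_sumr !mulr_suml; apply: eq_bigr => j _.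
    rewrite mulr_sumr !mulr_suml; apply: eq_bigr => l _.
    by rewrite swap !mxE.
  rewrite exchange_big; apply: eq_bigr => j _; rewrite /B mulr_sumr !mulr_suml.
  apply: eq_bigr => i _; rewrite mulr_sumr !mulr_suml; apply: eq_bigr => l _.
  by rewrite swap' !mxE.
by rewrite !sum_delta mulrBr !mulrA /B.
Qed.

(** * The Ricci operator of the warped product and the eigenvalue relation *)

Section FiberEigen.
Variable z : 'rV[R]_(1 + m).
Hypotheses (Wz : W (lsubmx z)) (Uz : U (rsubmx z)).
Local Notation x := (rsubmx z).
Local Notation qz := (q (lsubmx z)).

(** The trace of the wedge gives [m] copies of the metric minus one; the base direction contributes
    nothing. *)
Lemma ricci_warped X Y : ricci g z X Y = ricci G x (rsubmx X) (rsubmx Y)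
  - c * (m%:R - 1) * inner (G x) (rsubmx X) (rsubmx Y).
Proof.
rewrite !ricciE big_split_ord big_ord1 /= riem_warped// row_mxEl mxE add0r.
under eq_bigr => i _ do rewrite riem_warped// row_mxEr coordv_rshift row_mxKr
  fiber_curvatureE coordvE eqxx mulr1.
rewrite sumrB; congr (_ - _); rewrite -mulr_sumr -mulrA; congr (_ * _).
rewrite sumrB sumr_const card_ord mulrBl mulr_natl mul1r; congr (_ - _).
rewrite (linear_coordv (fun V => inner (G x) V (rsubmx Y))) => [|k V V'].
  by apply: eq_bigr => i _; rewrite mulrC.
by rewrite innerDl innerZl.
Qed.

Lemma inner_row_mx X (A : fiber) : inner (g z) (row_mx 0 A) X = qz * inner (G x) A (rsubmx X).
Proof.
rewrite /inner -[X in X^T]hsubmxK tr_row_mx.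
rewrite [row_mx 0 A *m _]mul_row_block !mul0mx mulmx0 !add0r.
by rewrite [_ *m col_mx _ _]mul_row_col mul0mx add0r -scalemxAr -scalemxAl mxE.
Qed.

Lemma R4_warped X Y Z V : R4 g z X Y Z V =
  qz * inner (G x) (fiber_curvature x (rsubmx X) (rsubmx Y) (rsubmx Z)) (rsubmx V).
Proof. by rewrite /R4 /lower riem_warped// inner_row_mx. Qed.

Lemma inner_fiber_curvature X Y Z V : inner (G x) (fiber_curvature x X Y Z) V =
  R4 G x X Y Z V - c * (inner (G x) Y Z * inner (G x) X V
                        - inner (G x) X Z * inner (G x) Y V).
Proof.
rewrite [LHS]innerDl innerNl innerZl; congr (_ - _ * _).
by rewrite innerDl innerNl !innerZl.
Qed.

Lemma ricci_mx_warped :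
  ricci_mx g z = block_mx 0 0 0 (ricci_mx G x - (c * (m%:R - 1)) *: G x).
Proof.
have dG := metric_derivable_christoffel _ _ GU _ Uz.
have inner0 (A : 'M[R]_m) V : inner A 0 V = 0 by rewrite /inner !mul0mx mxE.
have inner0r (A : 'M[R]_m) V : inner A V 0 = 0 by rewrite /inner trmx0 mulmx0 mxE.
apply/matrixP => i j; rewrite mxE ricci_warped ricci_inner_mx//.
case: (split_ordP i) => {}i ->; case: (split_ordP j) => {}j ->;
  rewrite ?(block_mxEul, block_mxEur, block_mxEdl, block_mxEdr)
          ?coordv_lshift ?coordv_rshift ?row_mxKr
          ?(inner0, inner0r) ?mulr0 ?subr0 ?inner_coordv ?[RHS]mxE//.
by rewrite [X in _ = _ + X]mxE [X in _ = _ - X]mxE.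
Qed.

Lemma ricci_op_mx_warped : ricci_op_mx g z =
  block_mx 0 0 0 (qz^-1 *: (ricci_op_mx G x - (c * (m%:R - 1))%:M)).
Proof.
have [_ _ Gu _] := GU.
rewrite /ricci_op_mx ricci_mx_warped invmx_warped// mulmx_block.
rewrite !(mul0mx, mulmx0, addr0, add0r); congr block_mx.
by rewrite -scalemxAr mulmxBl -scalemxAl mulmxV ?Gu// scalemx1.
Qed.

Lemma scalar_curvature_warped : scalar_curvature g z =
  qz^-1 * (scalar_curvature G x - c * (m%:R - 1) * m%:R).
Proof.
rewrite /scalar_curvature ricci_op_mx_warped mxtrace_block mxtrace0 add0r.
by rewrite mxtraceZ raddfB /= mxtrace_scalar mulr_natr.
Qed.

Hypothesis m_neq0 : m%:R != 0 :> R.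

(** The curvature condition on the fiber, freed from coordinate vectors, with [m] for n - 1 and [c]
    for eps a^2. *)
Hypothesis fiber_eigen : forall X Y Z V,
  R4 G x (X *m ricci_op_mx G x) Y Z V =
  scalar_curvature G x / m%:R * R4 G x X Y Z V
  + c * (inner (G x) Y Z * ricci G x X V - inner (G x) Y V * ricci G x X Z)
  - c * scalar_curvature G x / m%:R * G4 G x X Y Z V.

(** Up to the factor 1/q, the Ricci operator and kappa / m are those of the fiber lowered by the
    same constant [c * (m - 1)], which cancels. There remains the fiber Ricci operator acting as its
    scalar curvature over [m] on the fiber curvature minus [c] times [G4]: this is [fiber_eigen]
    rearranged. *)
Lemma warped_eigen X Y Z V : R4 g z (X *m ricci_op_mx g z) Y Z V =
  scalar_curvature g z / m%:R * R4 g z X Y Z V.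
Proof.
have dG := metric_derivable_christoffel _ _ GU _ Uz; have [_ _ Gu _] := GU.
have q0 := q_neq0 _ Wz.
have -> : X *m ricci_op_mx g z = row_mx 0 (qz^-1 *:
    ((- (c * (m%:R - 1))) *: rsubmx X + rsubmx X *m ricci_op_mx G x)).
  rewrite -[X in X *m _]hsubmxK ricci_op_mx_warped mul_row_block.
  rewrite !(mulmx0, addr0, add0r) -scalemxAr mulmxBr.
  by rewrite mul_mx_scalar scaleNr addrC.
rewrite !R4_warped row_mxKr !inner_fiber_curvature scalar_curvature_warped.
have R4Z k V1 V2 V3 V4 : R4 G x (k *: V1) V2 V3 V4 = k * R4 G x V1 V2 V3 V4.
  by rewrite /R4 /lower riem_scale1// innerZl.
rewrite R4Z (R4_linear1 _ _ GU)// fiber_eigen.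
rewrite !(innerDl, innerZl) -!ricci_inner ?Gu//.
rewrite /G4 /lower /wedge !(innerDl, innerNl, innerZl).
move: (R4 _ _ _ _ _ _) (ricci _ _ _ _) (ricci _ _ _ _) (scalar_curvature _ _).
move: (inner _ (rsubmx Y) _) (inner _ (rsubmx X) _) (inner _ (rsubmx X) _).
move: (inner _ (rsubmx Y) _) (q _) q0 (m%:R) m_neq0.
by move=> *; field; apply/andP.
Qed.

Lemma warped_semisymmetry (v : 'I_4 -> 'rV[R]_(1 + m)) (X Y : 'rV[R]_(1 + m)) :
  dot (riem g z) (tensor4 (C4 g z)) v X Y
    - dot (weyl g z) (tensor4 (R4 g z)) v X Y
  = ((1 + m)%:R - 2)^-1 * Qtensor (ricci g z) (tensor4 (R4 g z)) v X Y.
Proof.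
have dg := derivable_christoffel_warped z Wz Uz; have [_ GS Gu _] := GU.
have gu : g z \in unitmx.
  rewrite block_diag_mx_unit unitmxE det_mx11 unitfE p_neq0//=.
  by rewrite unitmxZ ?Gu// unitfE q_neq0.
have -> : ricci g z = fun V1 V2 => inner (g z) (V1 *m ricci_op_mx g z) V2.
  by apply/funext => V1; apply/funext => V2; rewrite ricci_inner.
(* The constant is dictated by the definition of [weyl]; in dimension [1 + m] it is the eigenvalue
   of [warped_eigen]. *)
apply: (@semisymmetry_of_eigen R (1 + m) (g z) (ricci_op_mx g z) (riem g z)
  (scalar_curvature g z / ((1 + m)%:R - 1)) ((1 + m)%:R - 2)^-1).
- rewrite /warped tr_block_mx !trmx0 linearZ /= GS//; congr (block_mx _ 0 0 _).
  by rewrite [P _]mx11_scalar tr_scalar_mx.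
- move=> V1 V2; rewrite -!ricci_inner// !ricci_warped (ricci_sym _ _ _ _ _ GU Uz).
  by rewrite (inner_sym _ (rsubmx V1)) ?GS.
- by move=> *; rewrite riem_add1// innerDl.
- by move=> *; rewrite riem_scale1// innerZl.
- by move=> *; exact: R4_skew12.
(* This symmetry and the next are inherited through [R4_warped] from the fiber curvature and the
   metric wedge. *)
- move=> V1 V2 V3 V4; rewrite -[LHS]/(R4 g z V1 V2 V3 V4) -[X in _ = - X]/(R4 g z V1 V2 V4 V3).
  rewrite !R4_warped !inner_fiber_curvature (R4_skew34 _ _ GU)//.
  move: (q _) (R4 _ _ _ _ _ _) (inner _ _ _) (inner _ _ _) (inner _ _ _) (inner _ _ _).
  by move=> *; ring.
- move=> V1 V2 V3 V4; rewrite -[LHS]/(R4 g z V1 V2 V3 V4) -[RHS]/(R4 g z V3 V4 V1 V2).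
  rewrite !R4_warped !inner_fiber_curvature (R4_pair _ _ GU)//; congr (_ * (_ - _ * _)).
  rewrite !(inner_sym _ (rsubmx V3)) ?GS// !(inner_sym _ (rsubmx V4)) ?GS//.
  move: (inner _ _ _) (inner _ _ _) (inner _ _ _) (inner _ _ _).
  by move=> *; ring.
- move=> V1 V2 V3 V4; rewrite -[LHS]/(R4 g z (V1 *m ricci_op_mx g z) V2 V3 V4).
  by rewrite warped_eigen natrD addrAC subrr add0r.
Qed.

End FiberEigen.

End WarpedProduct.

(** * Linear warping functions *)

Section LinearWarping.
Context {R : realType}.
Local Notation base := ('rV[R]_1).

Variables (W : set base) (P : base -> 'M[R]_1) (q f : base -> R) (eps a b : R).
Hypotheses (oW : open W) (fW : smooth W f) (eps2 : eps * eps = 1).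
Hypothesis f'_neq0 : forall t, W t -> partial 0 f t != 0.
Hypothesis PE : forall t, W t -> P t 0 0 = eps * partial 0 f t ^+ 2.
Hypothesis qE : forall t, W t -> q t = (a * f t + b) ^+ 2.
Hypothesis h_neq0 : forall t, W t -> a * f t + b != 0.

Local Notation f' := (partial 0 f).
Local Notation f'' := (partial 0 (partial 0 f)).

Let h t := a * f t + b.
(** For p = eps f'^2 and q = h^2 the equations of the warped section give p'/(2p), q'/(2q) and -
    [beta] q/p; these are their values, with 1/eps written as eps. *)
Let alpha t := f'' t / f' t.
Let beta t := a * f' t / h t.
Let gamma t := - (eps * a * h t / f' t).

Lemma eps_neq0 : eps != 0.
Proof. by apply/eqP => e0; move: eps2; rewrite e0 mul0r => /esym/eqP; rewrite oner_eq0. Qed.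

Lemma derivable_f t v : W t -> derivable f t v.
Proof. by move=> Wt; apply: diff_derivable; case: (fW 1) => df _; exact: df. Qed.

Lemma derivable_f' t v : W t -> derivable f' t v.
Proof. by move=> Wt; apply: diff_derivable; case: (fW 2) => _ /(_ 0)[df _]; exact: df. Qed.

Lemma derivable_f'' t v : W t -> derivable f'' t v.
Proof.
move=> Wt; apply: diff_derivable; case: (fW 3) => _ /(_ 0)[_ /(_ 0)[df _]]; exact: df.
Qed.

Lemma derivable_h t v : W t -> derivable h t v.
Proof.
move=> Wt; apply: derivableD; last exact: derivable_cst.
by apply: derivableM; [exact: derivable_cst|exact: derivable_f].
Qed.

Lemma partial_h t : W t -> partial 0 h t = a * f' t.
Proof.
move=> Wt; rewrite /partial deriveD ?derive_cst ?addr0//; last first.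
  by apply: derivableM; [exact: derivable_cst|exact: derivable_f].
rewrite derive_mul ?derive_cst ?mulr0 ?addr0//; exact: derivable_f.
Qed.

Lemma nearW t : W t -> \forall s \near t, W s.
Proof. by move=> Wt; exact: open_nbhs_nbhs. Qed.

Lemma partial_P t : W t ->
  partial 0 (fun t => P t 0 0) t = 2 * P t 0 0 * alpha t.
Proof.
move=> Wt; rewrite /partial (@near_eq_derive _ _ _ _ (fun t => f' t * f' t * eps)); last first.
  near=> s; rewrite PE; last by near: s; exact: nearW.
  by rewrite mulrC expr2.
have d := derivable_f' _ (coordv 0) Wt.
rewrite derive_mulC; last exact: (derivableM d d).
rewrite (derive_mul _ _ _ _ d d).
rewrite -/(partial 0 f t) -/(partial 0 (partial 0 f) t) PE// /alpha.
have := f'_neq0 _ Wt; move: (f' t) (f'' t) => x y x0; field.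
exact: x0.
Unshelve. all: by end_near.
Qed.

Lemma partial_q t : W t -> partial 0 q t = 2 * q t * beta t.
Proof.
move=> Wt; rewrite /partial (@near_eq_derive _ _ _ _ (fun t => h t * h t)); last first.
  near=> s; rewrite qE; last by near: s; exact: nearW.
  by rewrite expr2.
have d := derivable_h _ (coordv 0) Wt; rewrite (derive_mul _ _ _ _ d d).
rewrite -/(partial 0 h t) -/(partial 0 f t) partial_h//.
rewrite qE// /beta -/(h t); have := h_neq0 _ Wt; rewrite -/(h t).
by move: (f' t) (h t) => x w w0; field.
Unshelve. all: by end_near.
Qed.

(** As [beta] = h'/h, the first two terms add up to h''/h = a f''/h, which is [alpha * beta]. *)
Lemma partial_beta t : W t -> partial 0 beta t + beta t * beta t - alpha t * beta t = 0.
Proof.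
move=> Wt; have h0 := h_neq0 _ Wt; have f0 := f'_neq0 _ Wt.
rewrite /partial derive_mul; last 2 first.
- by apply: derivableM; [exact: derivable_cst|exact: derivable_f'].
- by apply: derivableV => //; exact: derivable_h.
rewrite deriveV//; last exact: derivable_h.
rewrite derive_mul; [|exact: derivable_cst|exact: derivable_f'].
rewrite derive_cst -/(partial 0 h t) -/(partial 0 f t) partial_h// -/(partial 0 (partial 0 f) t).
rewrite /alpha /beta; rewrite -/(h t) in h0; rewrite /GRing.scale/=.
move: (f' t) (f'' t) (h t) f0 h0 => x y w x0 w0; field.
by rewrite x0 w0.
Qed.

(** [gamma] is a constant multiple of h/f', hence its derivative is (h'/h - f''/f') [gamma], that is
    ([beta] - [alpha]) [gamma]. *)
Lemma partial_gamma t : W t ->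
  partial 0 gamma t + alpha t * gamma t - beta t * gamma t = 0.
Proof.
move=> Wt; have h0 := h_neq0 _ Wt; have f0 := f'_neq0 _ Wt.
have dh : derivable (fun t => eps * a * h t) t (coordv 0).
  by apply: derivableM; [exact: derivable_cst|exact: derivable_h].
have dv : derivable (fun t => (f' t)^-1) t (coordv 0).
  by apply: derivableV; [exact: f0|exact: derivable_f'].
rewrite /partial deriveN; last exact: (derivableM dh dv).
rewrite (derive_mul _ _ _ _ dh dv) (deriveV f0 (derivable_f' _ _ Wt)).
rewrite derive_mul; [|exact: derivable_cst|exact: derivable_h].
rewrite derive_cst -/(partial 0 h t) -/(partial 0 f t) partial_h// -/(partial 0 (partial 0 f) t).
rewrite /alpha /beta /gamma; rewrite -/(h t) in h0; rewrite /GRing.scale/=.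
move: (f' t) (f'' t) (h t) f0 h0 => x y w x0 w0; field.
by rewrite x0 w0.
Qed.

Lemma gammaE t : W t -> gamma t * P t 0 0 = - (beta t * q t).
Proof.
move=> Wt; have h0 := h_neq0 _ Wt; have f0 := f'_neq0 _ Wt.
rewrite PE// qE// /beta /gamma; rewrite -/(h t) in h0 *.
move: (f' t) (h t) f0 h0 => x w x0 w0.
by transitivity (- (eps * eps * (a * w * x))); [field|rewrite eps2; field].
Qed.

Lemma beta_gamma t : W t -> beta t * gamma t = - (eps * a ^+ 2).
Proof.
move=> Wt; have h0 := h_neq0 _ Wt; have f0 := f'_neq0 _ Wt.
rewrite /beta /gamma; rewrite -/(h t) in h0.
by move: (f' t) (h t) f0 h0 => x w x0 w0; field; rewrite x0 w0.
Qed.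

Section Fiber.
Context {m : nat}.
Variables (U : set 'rV[R]_m) (G : 'rV[R]_m -> 'M[R]_m) (z : 'rV[R]_(1 + m)).
Hypotheses (GU : metric_on U G) (Wz : W (lsubmx z)) (Uz : U (rsubmx z)).
Hypothesis m_neq0 : m%:R != 0 :> R.
Local Notation x := (rsubmx z).

Lemma linear_warping_semisymmetry :
  (forall X Y Z V,
    R4 G x (X *m ricci_op_mx G x) Y Z V =
    scalar_curvature G x / m%:R * R4 G x X Y Z V
    + eps * a ^+ 2 *
        (inner (G x) Y Z * ricci G x X V - inner (G x) Y V * ricci G x X Z)
    - eps * a ^+ 2 * scalar_curvature G x / m%:R * G4 G x X Y Z V) ->
  forall (v : 'I_4 -> 'rV[R]_(1 + m)) (X Y : 'rV[R]_(1 + m)),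
  dot (riem (warped P q G) z) (tensor4 (C4 (warped P q G) z)) v X Y
    - dot (weyl (warped P q G) z) (tensor4 (R4 (warped P q G) z)) v X Y
  = ((1 + m)%:R - 2)^-1 *
    Qtensor (ricci (warped P q G) z) (tensor4 (R4 (warped P q G) z)) v X Y.
Proof.
move=> eigen; apply: (@warped_semisymmetry R m W U P q G alpha beta gamma (eps * a ^+ 2));
  rewrite //.
- by move=> t Wt; rewrite PE// mulf_neq0 ?eps_neq0 ?expf_neq0 ?f'_neq0.
- by move=> t Wt; rewrite qE// expf_neq0 ?h_neq0.
- move=> t v Wt; apply: (@near_eq_derivable _ _ _ (fun t => h t * h t)).
    near=> s; rewrite qE; last by near: s; exact: nearW.
    by rewrite expr2.
  by apply: derivableM; exact: derivable_h.
- move=> t v Wt; apply: derivableM; first exact: derivable_f''.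
  by apply: derivableV; [exact: f'_neq0|exact: derivable_f'].
- move=> t v Wt; apply: derivableM.
    by apply: derivableM; [exact: derivable_cst|exact: derivable_f'].
  by apply: derivableV; [exact: h_neq0|exact: derivable_h].
- move=> t v Wt; apply: derivableN; apply: derivableM.
    by apply: derivableM; [exact: derivable_cst|exact: derivable_h].
  by apply: derivableV; [exact: f'_neq0|exact: derivable_f'].
- exact: partial_P.
- exact: partial_q.
- exact: gammaE.
- exact: partial_beta.
- exact: partial_gamma.
- exact: beta_gamma.
Unshelve. all: by end_near.
Qed.

End Fiber.
End LinearWarping.

(** * From charts to the manifold *)

Lemma derive_scale {R : realType} n (f : 'rV[R]_n -> R) x k v :
  differentiable f x -> 'D_(k *: v) f x = k * 'D_v f x.
Proof. by move=> df; rewrite !deriveE// linearZ. Qed.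

(* Abstracting the tensor values keeps [ring] from unfolding them when it
   compares atoms. *)
Local Ltac generalize_tensors :=
  repeat (let u := fresh in set u := R4 _ _ _ _ _ _; clearbody u);
  repeat (let u := fresh in set u := ricci _ _ _ _; clearbody u);
  repeat (let u := fresh in set u := inner _ _ _; clearbody u);
  repeat (let u := fresh in set u := scalar_curvature _ _; clearbody u).

Theorem theorem4p2 (R : realType) (n : nat) (hn : (4 <= n)%N)
    (Mbar : @charted_space R 1) (gbar : tensor_field02 Mbar)
    (hMbar : is_manifold Mbar) (hgbar : is_metric gbar)
    (x1 : Mbar -> R) (hx1 : global_coordinate x1)
    (eps : R) (heps : eps = 1 \/ eps = -1)
    (hgbar11 : coordinate_component gbar x1 eps)
    (a b : R)
    (Nt : @charted_space R n.-1) (gt : tensor_field02 Nt)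
    (hNt : is_manifold Nt) (hgt : is_metric gt)
    (hnotEinstein : ~ einstein gt)
    (hcurv : forall i x, chart_img (chart_at i) x ->
      forall mu be ga de : 'I_(n.-1),
        let d := @coordv R n.-1 in
        let St := fun p q => ricci (gt i) x (d p) (d q) in
        let kt := scalar_curvature (gt i) x in
        \sum_ep ricci_op_mx (gt i) x mu ep
                * R4 (gt i) x (d ep) (d be) (d ga) (d de)
        = kt / (n%:R - 1) * R4 (gt i) x (d mu) (d be) (d ga) (d de)
          + eps * a ^+ 2 * (gt i x be ga * St mu de - gt i x be de * St mu ga)
          - eps * kt * a ^+ 2 / (n%:R - 1)
            * G4 (gt i) x (d mu) (d be) (d ga) (d de))
    (F : Mbar -> R) (hFpos : forall p, 0 < F p)
    (hF : forall p, F p = (a * x1 p + b) ^+ 2) :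
  forall (c : chart_index (prod_space Mbar Nt)) z,
    chart_img (chart_at c) z ->
    let g := warped_metric gbar F gt c in
    let RR := tensor4 (R4 g z) in
    let CC := tensor4 (C4 g z) in
    forall (v : 'I_4 -> 'rV[R]_(1 + n.-1)) (X Y : 'rV[R]_(1 + n.-1)),
      dot (riem g z) CC v X Y - dot (weyl g z) RR v X Y
      = (n%:R - 2)^-1 * Qtensor (ricci g z) RR v X Y.
Proof.
(* With n = m + 1 the dimension [n.-1] of the fiber computes to [m]. *)
case: n hn Nt gt hNt hgt hnotEinstein hcurv => [//|m] hn Nt gt hNt hgt _ hcurv.
move=> [i j] z zI g RR CC v X Y.
have [Wz Uz] : chart_img (chart_at i) (lsubmx z) /\ chart_img (chart_at j) (rsubmx z).
  case: zI => -[p1 p2] [p1D p2D] <-; split; rewrite ?row_mxKl ?row_mxKr.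
    by exists p1.
  by exists p2.
have [_ _ _ _ [/(_ i) [_ oW _ _ _] _]] := hMbar.
have [_ _ _ _ [/(_ j) [_ oU _ _ _] _]] := hNt.
have [gtS gtu gtC _] := hgt.
have gtU : metric_on (chart_img (chart_at j)) (gt j).
  by split; [exact: oU|exact: gtS|exact: gtu|exact: gtC].
have [_ /(_ i) /= [fW f'0]] := hx1.
set f := x1 \o chart_inv (chart_at i) in fW f'0.
have m0 : (m : nat)%:R != 0 :> R by rewrite pnatr_eq0; case: (m) hn.
have eps2 : eps * eps = 1 by case: heps => ->; rewrite ?mulrNN mulr1.
have mE : m.+1%:R - 1 = m%:R :> R by rewrite -natr1 addrK.
apply: (@linear_warping_semisymmetry R (chart_img (chart_at i)) (gbar i)
  (F \o chart_inv (chart_at i)) f eps a b oW fW eps2 f'0 _ _ _ m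
  (chart_img (chart_at j)) (gt j)) => //.
(* The vector [(partial 0 f t)^-1 *: coordv 0] is d/dx^1 in this chart, as dx^1 takes the value 1 on
   it; its square norm [eps] gives the component eps f'^2. *)
- move=> t Wt; have df : differentiable f t by case: (fW 1) => df _; exact: df.
  have := hgbar11 i t Wt ((partial 0 f t)^-1 *: coordv 0).
  rewrite -/f derive_scale// mulVf ?f'0// => /(_ erefl).
  rewrite innerZl innerZr inner_coordv => <-.
  by move: (gbar i t 0 0) (partial 0 f t) (f'0 t Wt) => x y y0; field.
- by move=> t Wt; rewrite /= hF.
- move=> t Wt; have := hFpos (chart_inv (chart_at i) t); rewrite hF.
  by rewrite exprn_even_gt0.
have Ux := Uz; move: (rsubmx z) Ux => x Ux.
have dG := metric_derivable_christoffel _ _ gtU _ Ux.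
(* The condition on the fiber is given on coordinate vectors. The difference of its two sides is
   linear in each slot, so [linear_ext] extends it to all vectors. *)
move=> X' Y' Z' V'; apply/eqP; rewrite -subr_eq0; apply/eqP.
have G4E V1 V2 V3 V4 : G4 (gt j) x V1 V2 V3 V4 =
    inner (gt j x) V2 V3 * inner (gt j x) V1 V4
    - inner (gt j x) V1 V3 * inner (gt j x) V2 V4.
  by rewrite /G4 /lower /wedge innerDl innerNl !innerZl.
have R4l1 := R4_linear1 _ _ gtU x; have R4l2 := R4_linear2 _ _ gtU x.
have R4l3 := R4_linear3 _ _ gtU x; have R4l4 := R4_linear4 (gt j) x.
move: X'; apply: linear_ext => [k V1 V2|mu].
  rewrite mulmxDl -scalemxAl !G4E !(R4l1 _ _ _ _ _ _ Ux) !ricci_linear1//.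
  by rewrite !(innerDl, innerZl); generalize_tensors; ring.
move: Y'; apply: linear_ext => [k V1 V2|be].
  rewrite !G4E !(R4l2 _ _ _ _ _ _ Ux).
  by rewrite !(innerDl, innerZl, innerDr, innerZr); generalize_tensors; ring.
move: Z'; apply: linear_ext => [k V1 V2|ga].
  rewrite !G4E !(R4l3 _ _ _ _ _ _ Ux) !ricci_linear2//.
  by rewrite !(innerDl, innerZl, innerDr, innerZr); generalize_tensors; ring.
move: V'; apply: linear_ext => [k V1 V2|de].
  rewrite !G4E !R4l4 !ricci_linear2//.
  by rewrite !(innerDl, innerZl, innerDr, innerZr); generalize_tensors; ring.
have /= H := hcurv j x Ux mu be ga de.
rewrite mE in H; rewrite !inner_coordv.
(* Expanding the first slot, which holds row [mu] of the Ricci operator, produces the sum over [ep]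
   of the hypothesis. *)
rewrite (linear_coordv (fun V => R4 (gt j) x V _ _ _)) => [|k V1 V2]; last exact: R4l1.
under eq_bigr => ep _ do rewrite -rowE mxE.
by rewrite H [eps * _ * a ^+ 2]mulrAC subrr.
Qed.
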